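(* Let $\mathscr{S}$ be a smooth (of class $C^3$) oriented surface in three-dimensional Euclidean space, with unit normal $\bm{\nu}$. A non-trivial isometric deformation $\bm{y}$ of $\mathscr{S}$ (non-trivial meaning different from a uniform rotation, i.e. the polar rotation of $\bm{y}$ is not constant on $\mathscr{S}$) can be a pure drilling only if $\mathscr{S}$ is a minimal surface, for which $\bm{y}$ reduces to a classical Bonnet transformation.
   Context: Surface gradient: for a differentiable field $f$ on $\mathscr{S}$, $\nabla_{\mathrm s}f$ annihilates $\bm{\nu}$ and satisfies $\frac{d}{dt}f(\bm{x}(t))=(\nabla_{\mathrm s}f)\dot{\bm{x}}$ along every smooth curve $\bm{x}(t)$ on $\mathscr{S}$. The curvature tensor is $\nabla_{\mathrm s}\bm{\nu}$ (symmetric), and the mean curvature $H$ is given by $2H=\operatorname{tr}(\nabla_{\mathrm s}\bm{\nu})$; a minimal surface is one with $H=0$ identically. $\mathbf{P}(\bm{\nu})=\mathbf{I}-\bm{\nu}\otimes\bm{\nu}$; $\mathbf{W}(\bm{u})$ is the skew-symmetric tensor with $\mathbf{W}(\bm{u})\bm{v}=\bm{u}\times\bm{v}$. Deformation: a twice continuously differentiable map $\bm{y}$ of $\mathscr{S}$ onto a surface $\mathscr{S}^\ast=\bm{y}(\mathscr{S})$ with polar decomposition $\nabla_{\mathrm s}\bm{y}=\mathbf{R}\mathbf{U}$, where $\mathbf{U}(\bm{x})$ is symmetric and positive definite on the tangent plane to $\mathscr{S}$ at $\bm{x}$ ($\mathbf{U}\bm{\nu}=\bm{0}$) and $\mathbf{R}(\bm{x})\in\mathsf{SO}(3)$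 is the polar rotation; $\mathscr{S}^\ast$ is oriented by $\bm{\nu}^\ast=\mathbf{R}\bm{\nu}$. A deformation is isometric if it preserves both angles and area; equivalently $\nabla_{\mathrm s}\bm{y}=\mathbf{R}\mathbf{P}(\bm{\nu})$ with $\mathbf{R}(\bm{x})\in\mathsf{SO}(3)$. Every polar rotation is decomposed as $\mathbf{R}=\mathbf{R}_{\mathrm b}\mathbf{R}_{\mathrm d}$ with $\mathbf{R}_{\mathrm d}$ a rotation about $\bm{\nu}$ (drilling) and $\mathbf{R}_{\mathrm b}$ a rotation about an axis orthogonal to $\bm{\nu}$ (bending). A change of frame, represented by a constant $\mathbf{Q}\in\mathsf{SO}(3)$, changes $\mathbf{R}$ into $\mathbf{Q}\mathbf{R}$. A deformation is a pure drilling if there is a frame in which $\mathbf{R}_{\mathrm b}=\mathbf{I}$ on $\mathscr{S}$, i.e. in which $\mathbf{R}(\bm{x})$ is a rotation about $\bm{\nu}(\bm{x})$ for all $\bm{x}\in\mathscr{S}$; the assertion about $\bm{y}$ being a Bonnet transformation refers to that frame. Bonnet transformation of a minimal surface $\mathscr{S}$ (the one that, for instance, changes a catenoid into a helicoid): a map whose surface gradient is $\cos\alpha\,\mathbf{P}(\bm{\nu})+\sin\alpha\,\mathbf{W}(\bm{\nu})$ with $\alpha$ a constant, so that its polar rotation is the rotation by the constant angle $\alpha$ about $\bm{\nu}$.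
   Formalization: The surface is taken connected, and deformations that are a uniform rotation composed with a central inversion are excluded: y = -x on a sphere is an isometric pure drilling with non-constant polar rotation, yet the sphere is not minimal. *)

(* Defs.v *)
From HB Require Import structures.
From mathcomp Require Import all_boot all_order all_algebra.
From mathcomp Require Import all_classical all_reals all_analysis.
Set Implicit Arguments.
Unset Strict Implicit.
Unset Printing Implicit Defensive.
Import Order.TTheory GRing.Theory Num.Theory.
Import numFieldNormedType.Exports.
Local Open Scope classical_set_scope.
Local Open Scope ring_scope.

(* MathComp-Analysis, over an arbitrary [R : realType]. Points, vectors and
   tensors of Euclidean 3-space are 'cV[R]_3 and 'M[R]_3. The library norm
   `|v| on matrices is the sup norm (it only serves the topology and the
   derivatives); [enorm] is the Euclidean norm. *)

Section Tensors.
Context {R : realType}.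
Local Notation vec := 'cV[R]_3.
Local Notation tensor := 'M[R]_3.

Definition dot (u v : vec) : R := (u^T *m v) 0 0.

Definition enorm (v : vec) : R := Num.sqrt (dot v v).

(* Indices are added in 'I_3, i.e. modulo 3. *)
Definition cross (u v : vec) : vec :=
  \col_i (u (i + 1) 0 * v (i + 2) 0 - u (i + 2) 0 * v (i + 1) 0).

Definition cos_angle (u v : vec) : R := dot u v / (enorm u * enorm v).

Definition proj_tensor (n : vec) : tensor := 1%:M - n *m n^T.

Definition skew_tensor (u : vec) : tensor :=
  \matrix_(i, j) cross u (delta_mx j 0) i 0.

Lemma skew_tensorE (u v : vec) : skew_tensor u *m v = cross u v.
Proof.
apply/colP => i; rewrite mxE !big_ord_recr big_ord0 /= !mxE !eqxx !andbT.
case: i => [[|[|[|//]]] lti] /=; set a := u _ _; set b := u _ _;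
  rewrite ?(mulr0n, mulr1n, mulr0, mulr1, mul0r, subr0, sub0r, add0r, addr0)
    ?oppr0 ?mul0r ?add0r !mulNr 1?[- _ + _]addrC;
  congr (_ * v _ _ - _ * v _ _); exact/val_inj.
Qed.

Definition SO3 (A : tensor) : Prop := A^T *m A = 1%:M /\ \det A = 1.

Definition rotation_about (e : vec) (A : tensor) : Prop :=
  SO3 A /\ A *m e = e.

(* A = Rb Rd with Rd the drilling and Rb the bending part relative to n. *)
Definition bending_drilling (n : vec) (A Rb Rd : tensor) : Prop :=
  [/\ A = Rb *m Rd, rotation_about n Rd &
      exists e, [/\ dot e e = 1, dot e n = 0 & rotation_about e Rb]].

End Tensors.

(* Class C^k on a set A, meant for A open: f is C^(k+1) iff it is Frechet
   differentiable at each point of A with all directional derivatives C^k. *)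
Fixpoint class_C {R : realType} {V W : normedModType R} (k : nat) (A : set V)
    (f : V -> W) : Prop :=
  if k is k'.+1 then
    (forall q, A q -> differentiable f q) /\
    (forall v, class_C k' A (fun q => 'D_v f q))
  else forall q, A q -> {for q, continuous f}.

Section Surfaces.
Context {R : realType}.
Local Notation vec := 'cV[R]_3.
Local Notation tensor := 'M[R]_3.
Implicit Types (S : set vec) (nu y : vec -> vec) (Rot U : vec -> tensor).
(* Fields on S are functions on the whole space, of which only the values at
   points of S matter. *)

(* Local parametrization of class C^k: an immersion of the open set A that is a
   homeomorphism onto a relatively open subset of S (last clause). *)
Definition chart (k : nat) S (X : 'cV[R]_2 -> vec) (A : set 'cV[R]_2) : Prop :=
  [/\ open A /\ class_C k A X,
      (forall q, A q -> forall v, 'D_v X q = 0 -> v = 0),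
      (forall q r, A q -> A r -> X q = X r -> q = r) &
      (forall B, open B -> B `<=` A ->
         exists2 V : set vec, open V & X @` B = S `&` V)].

Definition surface (k : nat) S : Prop :=
  forall p, S p -> exists X A, chart k S X A /\ (X @` A) p.

(* Field of class C^k, k <= 3, on a surface of class C^3. *)
Definition class_C_on (k : nat) S (f : vec -> vec) : Prop :=
  forall X A, chart 3 S X A -> class_C k A (f \o X).

Definition curve_on S (x : vec) (c : R -> vec) : Prop :=
  c 0 = x /\
  exists2 e : R, 0 < e & forall t, `|t| < e ->
    [/\ S (c t), derivable c t 1 & {for t, continuous (derive1 c)}].

Definition tangent S (x : vec) : set vec :=
  [set v | exists2 c, curve_on S x c & v = derive1 c 0].

Definition unit_normal S nu : Prop :=
  {within S, continuous nu} /\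
  forall x, S x ->
    dot (nu x) (nu x) = 1 /\ forall v, tangent S x v -> dot (nu x) v = 0.

(* "G is the surface gradient of f at x"; there is at most one such G on a
   surface with unit normal nu. By translation of the parameter, it is enough
   to differentiate along curves at parameter 0. *)
Definition is_surface_grad S nu (f : vec -> vec) (x : vec) (G : tensor) : Prop :=
  G *m nu x = 0 /\
  forall c, curve_on S x c ->
    is_derive (0 : R) 1 (f \o c) (G *m derive1 c 0).

Definition is_mean_curvature S nu (x : vec) (H : R) : Prop :=
  exists2 G, is_surface_grad S nu nu x G & 2 * H = \tr G.

Definition minimal_surface S nu : Prop :=
  forall x, S x -> is_mean_curvature S nu x 0.

Definition polar_decomposition S nu y Rot U : Prop :=
  forall x, S x ->
    [/\ is_surface_grad S nu y x (Rot x *m U x),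
        SO3 (Rot x),
        (U x)^T = U x,
        U x *m nu x = 0 &
        forall v, tangent S x v -> v != 0 -> 0 < dot v (U x *m v)].

(* The image of S is a surface in the immersed sense, since U is positive
   definite on tangent planes; y is not required to be injective. *)
Definition deformation S nu y Rot U : Prop :=
  class_C_on 2 S y /\ polar_decomposition S nu y Rot U.

(* |cross v w| is the area of the parallelogram spanned by v and w. *)
Definition isometric S nu y : Prop :=
  forall x, S x -> exists G, [/\ is_surface_grad S nu y x G,
    (forall v w, tangent S x v -> tangent S x w -> v != 0 -> w != 0 ->
       cos_angle (G *m v) (G *m w) = cos_angle v w) &
    (forall v w, tangent S x v -> tangent S x w ->
       enorm (cross (G *m v) (G *m w)) = enorm (cross v w))].

(* The polar rotation is not constant. *)
Definition nontrivial S Rot : Prop :=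
  ~ exists Q, forall x, S x -> Rot x = Q.

(* The surface gradient of a uniform rotation followed by a central inversion.
   The polar rotation of such a y is x |-> Q (2 nu(x) nu(x)^T - I), which is
   not constant unless nu is, although y is an (improper) congruence of space:
   y = - x on a sphere is an isometric deformation whose polar rotation is the
   half-turn about nu. *)
Definition uniform_rotoinversion S nu y : Prop :=
  exists2 Q, SO3 Q & forall x, S x ->
    is_surface_grad S nu y x (- (Q *m proj_tensor (nu x))).

(* In the frame obtained through Q, the bending part of the polar rotation is
   the identity everywhere on S. *)
Definition drilling_frame S nu Rot (Q : tensor) : Prop :=
  SO3 Q /\
  forall x, S x -> exists Rd, bending_drilling (nu x) (Q *m Rot x) 1%:M Rd.

Definition pure_drilling S nu Rot : Prop :=
  exists Q, drilling_frame S nu Rot Q.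

Definition bonnet_transformation S nu y : Prop :=
  minimal_surface S nu /\
  exists alpha : R, forall x, S x ->
    is_surface_grad S nu y x
      (cos alpha *: proj_tensor (nu x) + sin alpha *: skew_tensor (nu x)).

End Surfaces.

(* Main.v *)
Require Import Defs.
From HB Require Import structures.
From mathcomp Require Import all_boot all_order all_algebra.
From mathcomp Require Import all_classical all_reals all_analysis.
From mathcomp Require Import ring lra.
Import Order.TTheory GRing.Theory Num.Theory.
Import numFieldNormedType.Exports.
Local Open Scope classical_set_scope.
Local Open Scope ring_scope.

(** In the frame where the bending is trivial, the surface gradient of the
    isometric deformation [z] is [a P(nu) + b W(nu)] with [a ^+ 2 + b ^+ 2 = 1].
    In a chart [X], with partial derivatives [X_i] and [N = nu \o X], this reads
    [z_i = a X_i + b (N x X_i)], and the symmetry [z_12 = z_21] becomes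
    [a_2 X_1 + b_2 (N x X_1) + b (N_2 x X_1)
       = a_1 X_2 + b_1 (N x X_2) + b (N_1 x X_2)].
    Its normal component is [b tr(grad nu) = 0].  Its tangential component is,
    writing [a + i b = exp(i alpha)] and [i] for [N x _], the relation
    [alpha_2 X_1 = alpha_1 X_2], so that [alpha] is locally constant, hence
    constant.  If [b = 0] then [a = 1] or [a = -1]: [y] is a uniform rotation or a
    uniform rotoinversion; otherwise the mean curvature vanishes. *)

(** * Vector algebra in Euclidean 3-space *)

Section VectorAlgebra.
Context {R : realType}.
Implicit Types (u v w n : 'cV[R]_3) (A : 'M[R]_3) (k : R).

Lemma sum3E (V : nmodType) (F : 'I_3 -> V) : \sum_i F i = F 0 + F 1 + F 2.
Proof.
rewrite !big_ord_recr big_ord0 /= add0r.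
by congr (F _ + F _ + F _); apply: val_inj.
Qed.

Lemma ord3P (P : 'I_3 -> Prop) : P 0 -> P 1 -> P 2 -> forall i, P i.
Proof.
move=> P0 P1 P2 [[|[|[|//]]] lti].
- by rewrite (_ : Ordinal _ = 0) //; apply: val_inj.
- by rewrite (_ : Ordinal _ = 1) //; apply: val_inj.
- by rewrite (_ : Ordinal _ = 2) //; apply: val_inj.
Qed.

Lemma vec3P u v : u 0 0 = v 0 0 -> u 1 0 = v 1 0 -> u 2 0 = v 2 0 -> u = v.
Proof. by move=> *; apply/colP; apply: ord3P. Qed.

Lemma dotE u v : dot u v = u 0 0 * v 0 0 + u 1 0 * v 1 0 + u 2 0 * v 2 0.
Proof. by rewrite /dot mxE sum3E !mxE. Qed.

Lemma ord3_12 : (1 + 2 : 'I_3) = 0. Proof. exact: val_inj. Qed.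
Lemma ord3_21 : (2 + 1 : 'I_3) = 0. Proof. exact: val_inj. Qed.
Lemma ord3_22 : (2 + 2 : 'I_3) = 1. Proof. exact: val_inj. Qed.
Lemma ord3_11 : (1 + 1 : 'I_3) = 2. Proof. exact: val_inj. Qed.
Definition ord3E := (ord3_12, ord3_21, ord3_22, ord3_11, add0r).

Lemma crossE u v : (cross u v 0 0 = u 1 0 * v 2 0 - u 2 0 * v 1 0) *
  (cross u v 1 0 = u 2 0 * v 0 0 - u 0 0 * v 2 0) *
  (cross u v 2 0 = u 0 0 * v 1 0 - u 1 0 * v 0 0).
Proof. by rewrite !mxE !ord3E. Qed.

Definition vec3E := (dotE, crossE).

Ltac vec_coord :=
  rewrite ?(vec3E, mxE) ?sum3E ?(vec3E, mxE) ?sum3E ?(vec3E, mxE) ?ord3E.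
Ltac vec_ring := vec_coord; ring.
Ltac vec_eq := apply: vec3P; vec_coord; ring.

Lemma dotC u v : dot u v = dot v u. Proof. vec_ring. Qed.
Lemma dotDl u v w : dot (u + v) w = dot u w + dot v w. Proof. vec_ring. Qed.
Lemma dotDr u v w : dot u (v + w) = dot u v + dot u w. Proof. vec_ring. Qed.
Lemma dotZl k u v : dot (k *: u) v = k * dot u v. Proof. vec_ring. Qed.
Lemma dotZr k u v : dot u (k *: v) = k * dot u v. Proof. vec_ring. Qed.
Lemma dotNl u v : dot (- u) v = - dot u v. Proof. vec_ring. Qed.
Lemma dotNr u v : dot u (- v) = - dot u v. Proof. vec_ring. Qed.
Lemma dot0l v : dot 0 v = 0. Proof. vec_ring. Qed.
Lemma dot0r v : dot v 0 = 0. Proof. vec_ring. Qed.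
Definition dot_lin := (dotDl, dotDr, dotZl, dotZr, dotNl, dotNr, dot0l, dot0r).

Lemma dot_ge0 u : 0 <= dot u u.
Proof. by rewrite dotE !addr_ge0 // -expr2 sqr_ge0. Qed.

(** Serves to drop from the two expansions of [z_12 = z_21] the terms in the mixed derivative of the
    chart: [y] stands for [X_12] and [t] for [N x X_12]. *)
Lemma vec_cancel p r s p' r' s' (y t : 'cV[R]_3) (a b : R) :
  p + a *: y + (r + b *: (s + t)) = p' + a *: y + (r' + b *: (s' + t)) ->
  p + (r + b *: s) = p' + (r' + b *: s').
Proof.
move=> E; apply/colP => i; have /colP/(_ i) := E; rewrite !mxE; lra.
Qed.

Lemma dot_eq0 u : dot u u = 0 -> u = 0.
Proof.
rewrite dotE -!expr2 => /eqP; rewrite !paddr_eq0 ?addr_ge0 ?sqr_ge0 //.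
rewrite !sqrf_eq0 => /andP[/andP[/eqP u0 /eqP u1] /eqP u2].
by apply: vec3P; rewrite mxE.
Qed.

Lemma dot_gt0 u : u != 0 -> 0 < dot u u.
Proof.
move=> u0; rewrite lt_neqAle dot_ge0 andbT eq_sym.
by apply: contra u0 => /eqP/dot_eq0 ->.
Qed.

Lemma dot_mulmxr A u v : dot u (A *m v) = dot (A^T *m u) v.
Proof. by rewrite /dot trmx_mul trmxK mulmxA. Qed.

Lemma crossDl u v w : cross (u + v) w = cross u w + cross v w.
Proof. vec_eq. Qed.
Lemma crossDr u v w : cross u (v + w) = cross u v + cross u w.
Proof. vec_eq. Qed.
Lemma crossZl k u v : cross (k *: u) v = k *: cross u v. Proof. vec_eq. Qed.
Lemma crossZr k u v : cross u (k *: v) = k *: cross u v. Proof. vec_eq. Qed.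
Lemma cross0r u : cross u 0 = 0. Proof. vec_eq. Qed.
Lemma crossC u v : cross u v = - cross v u. Proof. vec_eq. Qed.
Lemma crossvv u : cross u u = 0. Proof. vec_eq. Qed.

Lemma dot_crossC u v w : dot u (cross v w) = dot w (cross u v).
Proof. vec_ring. Qed.
Lemma dot_crossl u v : dot u (cross u v) = 0. Proof. vec_ring. Qed.
Lemma dot_crossr u v : dot u (cross v u) = 0. Proof. vec_ring. Qed.

Lemma double_cross u v w : cross u (cross v w) = dot u w *: v - dot u v *: w.
Proof. vec_eq. Qed.

Lemma dot_cross_cross u v : dot (cross u v) (cross u v) =
  dot u u * dot v v - dot u v ^+ 2.
Proof. vec_ring. Qed.

(** Expanding [n x (u x v)] leaves only multiples of [n . u] and [n . v], so it vanishes; a second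
    product with [n] then isolates [u x v]. *)
Lemma cross_normal n u v : dot n n = 1 -> dot n u = 0 -> dot n v = 0 ->
  cross u v = dot n (cross u v) *: n.
Proof.
move=> n1 nu nv; have : cross n (cross n (cross u v)) = 0.
  by rewrite (double_cross n u v) nu nv !scale0r subrr cross0r.
by rewrite double_cross n1 scale1r => /eqP; rewrite subr_eq0 => /eqP.
Qed.

(** Expand [e x (v x e)], in which [v x e] is along [n]. The factor [dot e e] on the left avoids a
    division. *)
Lemma plane_decomposition n e v :
  dot n n = 1 -> dot n e = 0 -> dot n v = 0 ->
  dot e e *: v = dot e v *: e + dot (cross n e) v *: cross n e.
Proof.
move=> n1 ne nv; have := double_cross e v e.
rewrite (cross_normal n v e) // crossZr (crossC e n) => /eqP.
rewrite eq_sym subr_eq => /eqP ->; rewrite addrC scalerN -scaleNr.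
by congr (_ + _ *: _); vec_ring.
Qed.

(** Expresses a tangent vector in the partial derivatives of a chart: for [u], [v], [w] orthogonal
    to [n], the last term vanishes because [u x v] is along [n]. *)
Lemma cramer u v w n : dot n (cross u v) *: w =
  dot n (cross w v) *: u + dot n (cross u w) *: v + dot w (cross u v) *: n.
Proof. vec_eq. Qed.

Lemma cross_eq0 u v : cross u v = 0 -> dot u u *: v = dot u v *: u.
Proof.
move=> uv0; apply/eqP; rewrite eq_sym -subr_eq0 -double_cross uv0 cross0r.
by rewrite eqxx.
Qed.

(** * Tensors on the tangent plane; determinant and trace *)

Lemma proj_tensorE n v : proj_tensor n *m v = v - dot n v *: n.
Proof.
rewrite /proj_tensor mulmxBl mul1mx -mulmxA; congr (_ - _).
by apply: vec3P; rewrite ?vec3E !mxE !big_ord1 ?sum3E !mxE ?sum3E !mxE; ring.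
Qed.

Lemma proj_tensor_tangent n v : dot n v = 0 -> proj_tensor n *m v = v.
Proof. by rewrite proj_tensorE => ->; rewrite scale0r subr0. Qed.

Lemma eq_mulmx_vec m p (A B : 'M[R]_(m, p)) :
  (forall v : 'cV[R]_p, A *m v = B *m v) -> A = B.
Proof.
move=> AB; apply/matrixP => i j.
by have /colP/(_ i) := AB (delta_mx j 0); rewrite -!colE !mxE.
Qed.

Lemma eq_tensor n (A B : 'M[R]_3) : dot n n = 1 -> A *m n = B *m n ->
  (forall v, dot n v = 0 -> A *m v = B *m v) -> A = B.
Proof.
move=> n1 ABn AB; apply: eq_mulmx_vec => v.
have nt : dot n (v - dot n v *: n) = 0.
  by rewrite !dot_lin n1 mulr1 subrr.
rewrite -[v](subrK (dot n v *: n)); move: (v - _) nt => t nt.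
by rewrite !mulmxDr -!scalemxAr ABn AB.
Qed.


Lemma det3E A : \det A =
  A 0 0 * (A 1 1 * A 2 2 - A 1 2 * A 2 1)
  - A 0 1 * (A 1 0 * A 2 2 - A 1 2 * A 2 0)
  + A 0 2 * (A 1 0 * A 2 1 - A 1 1 * A 2 0).
Proof.
rewrite (expand_det_row _ 0) sum3E /cofactor.
rewrite !(expand_det_row _ (0 : 'I_2)) !big_ord_recr !big_ord0 /cofactor /=.
rewrite !det_mx11 !mxE.
(* The cofactor expansion leaves entries at lifted indices; through [inord] these depend on natural
   numbers only, which compute to a common form for [ring]. *)
pose f i j := A (inord i) (inord j).
have Af i j : A i j = f i j by rewrite /f !inord_val.
by rewrite !Af /= /bump /= !(expr0, expr1); ring.
Qed.

(** The cofactor identity; for a rotation it yields compatibility with the cross product. *)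
Lemma trmx_mul_cross A u v : A^T *m cross (A *m u) (A *m v) = \det A *: cross u v.
Proof. by rewrite det3E; vec_eq. Qed.

(** This is the part of first order in [t] of the action of [1 + t A] on the triple product, since
    [det (1 + t A) = 1 + t tr A + ...]. *)
Lemma det_trace A u v w :
  dot (A *m u) (cross v w) + dot u (cross (A *m v) w)
  + dot u (cross v (A *m w)) = \tr A * dot u (cross v w).
Proof. by rewrite /mxtrace; vec_ring. Qed.

Lemma tangential_trace A n u v : A *m n = 0 ->
  \tr A * dot n (cross u v) = dot n (cross (A *m u) v) - dot n (cross (A *m v) u).
Proof.
move=> An; have := det_trace A u v n; rewrite An cross0r dot0r addr0.
rewrite !(dot_crossC _ _ n) => <-.
by rewrite [cross u (A *m v)]crossC dotNr.
Qed.

(** The passage from the normal component of the compatibility relation to zero mean curvature: [A]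
    is the curvature tensor, [u] and [v] are [X_1] and [X_2], [u'] and [v'] the derivatives of the
    normal, and [k] is the sine coefficient. *)
Lemma tangential_trace_eq0 A n u v u' v' k : A *m n = 0 ->
  A *m u = u' -> A *m v = v' -> dot n (cross u v) != 0 -> k != 0 ->
  k * dot n (cross u' v) = k * dot n (cross v' u) -> \tr A = 0.
Proof.
move=> An Au Av uv k0 /(mulfI k0); rewrite -Au -Av => E; apply: (mulIf uv).
by rewrite tangential_trace // E subrr mul0r.
Qed.

(** * Rotations and their decomposition about an axis *)

Lemma SO3_mulT A : SO3 A -> A *m A^T = 1%:M.
Proof. by move=> [AA _]; exact: mulmx1C. Qed.

Lemma SO3_tr A : SO3 A -> SO3 A^T.
Proof. by move=> SA; split; [rewrite trmxK SO3_mulT|rewrite det_tr; case: SA]. Qed.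

Lemma SO3_cross A u v : SO3 A -> cross (A *m u) (A *m v) = A *m cross u v.
Proof.
move=> SA; have /(congr1 (mulmx A)) := trmx_mul_cross A u v.
by rewrite mulmxA SO3_mulT // mul1mx SA.2 scale1r.
Qed.

Lemma SO3_dot A u v : SO3 A -> dot (A *m u) (A *m v) = dot u v.
Proof. by move=> [AA _]; rewrite dot_mulmxr mulmxA AA mul1mx. Qed.

(* On the plane orthogonal to [n], a rotation about [n] commutes with
   [cross n], hence is determined by the image of one vector. *)
Lemma rotation_about_tangent n A : dot n n = 1 -> rotation_about n A ->
  exists a b, a ^+ 2 + b ^+ 2 = 1 /\
    forall v, dot n v = 0 -> A *m v = a *: v + b *: cross n v.
Proof.
move=> n1 [SA An].
have [e [e0 ne]] : exists e, e != 0 /\ dot n e = 0.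
  (* The products of [n] with the first two basis vectors contain all three coordinates of [n] up to
     sign, so they cannot both vanish. *)
  pose e i := cross n (delta_mx i 0).
  have ei i : dot n (e i) = 0 by rewrite dot_crossl.
  have [e0|e0] := eqVneq (e 0) 0; last by exists (e 0).
  have [e1|e1] := eqVneq (e 1) 0; last by exists (e 1).
  exfalso; move: n1; rewrite dotE.
  move/colP: e0; move/colP: e1 => e1 e0.
  move: (e0 1) (e0 2) (e1 2).
  rewrite ![e _ _ _]crossE !mxE /= !(mulr1, mulr0, subr0, sub0r) => -> /eqP.
  rewrite oppr_eq0 => /eqP -> ->.
  by rewrite !mulr0 !addr0 => /eqP; rewrite eq_sym oner_eq0.
have ee : dot e e != 0 by rewrite gt_eqF ?dot_gt0.
have nAe : dot n (A *m e) = 0 by rewrite -{1}An SO3_dot.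
pose a := dot e (A *m e) / dot e e; pose b := dot (cross n e) (A *m e) / dot e e.
have Ae : A *m e = a *: e + b *: cross n e.
  apply: (scalerI ee); rewrite (plane_decomposition n e (A *m e)) // scalerDr.
  by rewrite !scalerA ![dot e e * _]mulrC !divfK.
clearbody a b.
have Ane : A *m cross n e = a *: cross n e - b *: e.
  rewrite -SO3_cross // An Ae crossDr !crossZr double_cross n1 ne.
  by rewrite scale0r sub0r scale1r scalerN.
exists a, b; split.
  have := SO3_dot A e e SA; rewrite Ae !dot_lin dot_crossr dotC dot_crossr.
  rewrite dot_cross_cross n1 ne expr0n subr0 !mul1r !mulr0 addr0 add0r !mulrA -mulrDl.
  by rewrite -!expr2 -{2}[dot e e]mul1r => /(mulIf ee).
move=> v nv; apply: (scalerI ee).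
rewrite scalemxAr scalerDr !(scalerA (dot e e)) ![dot e e * _]mulrC.
rewrite -!(scalerA _ (dot e e)) -crossZr (plane_decomposition n e v) //.
rewrite mulmxDr -!scalemxAr Ae Ane crossDr !crossZr double_cross n1 ne.
by apply: vec3P; rewrite !mxE; ring.
Qed.

Lemma rotation_about_tensor n A : dot n n = 1 -> rotation_about n A ->
  exists a b, a ^+ 2 + b ^+ 2 = 1 /\
    A *m proj_tensor n = a *: proj_tensor n + b *: skew_tensor n.
Proof.
move=> n1 rA; have [a [b [ab1 Av]]] := rotation_about_tangent n A n1 rA.
exists a, b; split=> //; apply: (eq_tensor n) => // [|v nv].
  rewrite -mulmxA [RHS]mulmxDl -!scalemxAl skew_tensorE crossvv proj_tensorE n1.
  by rewrite scale1r subrr mulmx0 !scaler0 addr0.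
rewrite -mulmxA [RHS]mulmxDl -!scalemxAl skew_tensorE.
by rewrite !proj_tensor_tangent // Av.
Qed.

(** * Isometries of a plane and the stretch tensor *)

Lemma enorm_eq0 u : enorm u = 0 -> u = 0.
Proof.
by move=> /eqP; rewrite sqrtr_eq0 => u0; apply/dot_eq0/le_anti; rewrite u0 dot_ge0.
Qed.

(** Holds for zero vectors too: division by zero gives 0, which agrees with the dot product. *)
Lemma cos_angle_eq0 u v : cos_angle u v = 0 <-> dot u v = 0.
Proof.
split=> [|uv0]; last by rewrite /cos_angle uv0 mul0r.
move=> /eqP; rewrite /cos_angle mulf_eq0 invr_eq0 mulf_eq0.
by case/or3P=> /eqP // /enorm_eq0 ->; rewrite !dot_lin.
Qed.

(** Take [w = n x v]. The pairs [v], [w] and [v + w], [v - w] are orthogonal, hence so are their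
    images, and [A v], [A w] have equal lengths. They span a square whose area is the squared length
    of [A v], and equality of areas concludes. *)
Lemma conformal_equiareal_isometry n A : dot n n = 1 ->
  (forall v w, dot n v = 0 -> dot n w = 0 -> v != 0 -> w != 0 ->
     cos_angle (A *m v) (A *m w) = cos_angle v w) ->
  (forall v w, dot n v = 0 -> dot n w = 0 ->
     enorm (cross (A *m v) (A *m w)) = enorm (cross v w)) ->
  forall v, dot n v = 0 -> dot (A *m v) (A *m v) = dot v v.
Proof.
move=> n1 Acos Aarea v nv.
have Aperp u w : dot n u = 0 -> dot n w = 0 -> dot u w = 0 ->
    dot (A *m u) (A *m w) = 0.
  move=> nu nw uw.
  have [->|u0] := eqVneq u 0; first by rewrite mulmx0 dot0l.
  have [->|w0] := eqVneq w 0; first by rewrite mulmx0 dot0r.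
  by apply/cos_angle_eq0; rewrite Acos //; apply/cos_angle_eq0.
pose w := cross n v.
have nw : dot n w = 0 by rewrite dot_crossl.
have vw : dot v w = 0 by rewrite dot_crossr.
have ww : dot w w = dot v v by rewrite dot_cross_cross n1 nv expr0n subr0 mul1r.
clearbody w.
have Avw : dot (A *m v) (A *m w) = 0 by exact: Aperp.
have Aww : dot (A *m w) (A *m w) = dot (A *m v) (A *m v).
  have := Aperp (v + w) (v - w); rewrite !mulmxDr mulmxN !dot_lin nv nw ww.
  rewrite (dotC w v) (dotC (A *m w)) vw Avw => /(_ _ _ _)/eqP.
  by rewrite !(oppr0, addr0, add0r) subrr subr_eq0 => /(_ erefl erefl erefl)/eqP.
have := Aarea v w nv nw => /(congr1 (fun x => x ^+ 2)).
rewrite !sqr_sqrtr ?dot_ge0 // !dot_cross_cross vw Avw Aww ww -!expr2.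
by rewrite expr0n !subr0 => /eqP; rewrite eqrXn2 ?dot_ge0 // => /eqP.
Qed.

(** A symmetric isometry of the plane is an involution there, so [w = A v - v] satisfies
    [dot w (A w) = - dot w w]; positivity of [A] forces [w = 0]. *)
Lemma symmetric_isometry_proj n A : dot n n = 1 -> A^T = A -> A *m n = 0 ->
  (forall v, dot n v = 0 -> v != 0 -> 0 < dot v (A *m v)) ->
  (forall v, dot n v = 0 -> dot (A *m v) (A *m v) = dot v v) ->
  A = proj_tensor n.
Proof.
move=> n1 AT An Apos Aiso.
have nA v : dot n (A *m v) = 0 by rewrite dot_mulmxr AT An dot0l.
apply: (eq_tensor n) => // [|v nv].
  by rewrite An proj_tensorE n1 scale1r subrr.
rewrite proj_tensor_tangent //; apply/eqP; rewrite -subr_eq0.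
apply/negPn/negP => w0.
have nw : dot n (A *m v - v) = 0 by rewrite !dot_lin nA nv subrr.
have := Apos _ nw w0.
have := Aiso _ nw; have := Aiso _ nv; have := Aiso _ (nA v).
have := dot_gt0 _ w0; have := dot_mulmxr A v (A *m v); rewrite AT.
rewrite !mulmxDr !mulmxN !dot_lin.
rewrite (dotC v (A *m v)) (dotC (A *m (A *m v)) (A *m v)); lra.
Qed.

(** The pointwise algebra of the argument: [x1], [x2] are the partial derivatives of the chart,
    [n1], [n2] those of the normal, and [a1], [a2], [b1], [b2] those of the two coefficients. *)
Lemma drilling_compatibility n x1 x2 n1 n2 (a b a1 a2 b1 b2 : R) :
  dot n n = 1 -> dot n x1 = 0 -> dot n x2 = 0 -> dot n n1 = 0 -> dot n n2 = 0 ->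
  dot n (cross x1 x2) != 0 -> a ^+ 2 + b ^+ 2 = 1 ->
  a * a1 + b * b1 = 0 -> a * a2 + b * b2 = 0 ->
  a2 *: x1 + (b2 *: cross n x1 + b *: cross n2 x1) =
  a1 *: x2 + (b1 *: cross n x2 + b *: cross n1 x2) ->
  [/\ a1 = 0, a2 = 0, b1 = 0, b2 = 0 &
      b * dot n (cross n1 x2) = b * dot n (cross n2 x1)].
Proof.
move=> nn nx1 nx2 nn1 nn2 x12 ab ab1 ab2 E.
have Eb : b * dot n (cross n1 x2) = b * dot n (cross n2 x1).
  by have := congr1 (dot n) E; rewrite !dot_lin !dot_crossl nx1 nx2; lra.
have Et : a2 *: x1 + b2 *: cross n x1 = a1 *: x2 + b1 *: cross n x2.
  move: E; rewrite (cross_normal n n1) // (cross_normal n n2) // !scalerA Eb.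
  by rewrite !addrA => /addIr.
(* With [a + i b = exp(i alpha)], these are the partial derivatives of [alpha], obtained without
   choosing an angle. *)
pose c1 := a * b1 - b * a1; pose c2 := a * b2 - b * a2.
have a1E : a1 = - (b * c1).
  by rewrite -[LHS]mul1r -ab; apply/eqP; rewrite -subr_eq0; apply/eqP;
     rewrite /c1 -[RHS](mulr0 a) -ab1; ring.
have a2E : a2 = - (b * c2).
  by rewrite -[LHS]mul1r -ab; apply/eqP; rewrite -subr_eq0; apply/eqP;
     rewrite /c2 -[RHS](mulr0 a) -ab2; ring.
have b1E : b1 = a * c1.
  by rewrite -[LHS]mul1r -ab; apply/eqP; rewrite -subr_eq0; apply/eqP;
     rewrite /c1 -[RHS](mulr0 b) -ab1; ring.
have b2E : b2 = a * c2.
  by rewrite -[LHS]mul1r -ab; apply/eqP; rewrite -subr_eq0; apply/eqP;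
     rewrite /c2 -[RHS](mulr0 b) -ab2; ring.
clearbody c1 c2.
(* The tangential relation becomes [a (n x u) = b u]. Its products with [u] and [n x u] give
   [b |u|^2 = a |u|^2 = 0], so [u = 0], and independence of [x1], [x2] gives [c1 = c2 = 0]. *)
pose u := c2 *: x1 - c1 *: x2.
have nu : dot n u = 0 by rewrite !dot_lin nx1 nx2; ring.
have uE : a *: cross n u = b *: u.
  rewrite /u crossDr -scaleNr !crossZr; move: Et; rewrite a1E a2E b1E b2E => Et.
  apply/eqP; rewrite -subr_eq0; apply/eqP.
  move/eqP: Et; rewrite -subr_eq0 => /eqP <-.
  by apply: vec3P; rewrite !mxE; ring.
have bu : b * dot u u = 0 by rewrite -dotZr -uE dotZr dot_crossr mulr0.
have au : a * dot u u = 0.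
  have <- : dot (cross n u) (cross n u) = dot u u.
    by rewrite dot_cross_cross nn nu expr0n subr0 mul1r.
  by rewrite -dotZr uE dotZr dotC dot_crossr mulr0.
have u0 : u = 0.
  apply: dot_eq0; rewrite -[LHS]mul1r -ab mulrDl !expr2 -!mulrA au bu.
  by rewrite !mulr0 addr0.
have c10 : c1 = 0.
  apply/eqP; have /eqP := congr1 (fun t => dot n (cross x1 t)) u0.
  rewrite /u crossDr -scaleNr !crossZr crossvv scaler0 add0r cross0r !dot_lin.
  by rewrite mulf_eq0 (negbTE x12) orbF oppr_eq0.
have c20 : c2 = 0.
  apply/eqP; have /eqP := congr1 (fun t => dot n (cross t x2)) u0.
  rewrite /u crossDl -scaleNr !crossZl crossvv scaler0 addr0.
  rewrite (crossC 0) cross0r oppr0 !dot_lin.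
  by rewrite mulf_eq0 (negbTE x12) orbF.
by split=> //; rewrite ?a1E ?a2E ?b1E ?b2E ?c10 ?c20 ?mulr0 ?oppr0.
Qed.

End VectorAlgebra.

(** * Differential calculus *)

Section Calculus.
Context {R : realType}.

(** Clearing the quotient gives a bound that also holds at [h = 0], so that estimates can be
    combined on full neighbourhoods. *)
Lemma is_deriveP {V W : normedModType R} (f : V -> W) (q v : V) (D : W) :
  is_derive q v f D <-> forall e : R, 0 < e ->
    \forall h \near (0 : R), `|f (h *: v + q) - f q - h *: D| <= e * `|h|.
Proof.
have quotE (h : R) : h != 0 ->
    `|D - h^-1 *: (f (h *: v + q) - f q)| =
    `|f (h *: v + q) - f q - h *: D| / `|h|.
  move=> h0; rewrite distrC -{1}[D](scalerK h0) -scalerBr normrZ normfV.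
  by rewrite mulrC.
split=> [fD e e0|H].
  have /cvgrPdist_le/(_ e e0) : h^-1 *: (f (h *: v + q) - f q) @[h --> 0^'] --> D.
    by have [dv <-] := fD; exact: dv.
  rewrite near_withinE; apply: filterS => h Hh; have [->|h0] := eqVneq h 0.
    by rewrite !scale0r add0r subrr subr0 !normr0 mulr0.
  by have := Hh h0; rewrite quotE // ler_pdivrMr ?normr_gt0.
have cvD : h^-1 *: (f (h *: v + q) - f q) @[h --> 0^'] --> D.
  apply/cvgrPdist_le => e e0; rewrite near_withinE.
  apply: filterS (H e e0) => h He h0.
  by rewrite quotE // ler_pdivrMr ?normr_gt0.
by split; [apply/cvg_ex; exists D | exact/cvg_lim].
Qed.

Lemma diff_near {V W : normedModType R} (f : V -> W) (q : V) :
  differentiable f q -> forall e : R, 0 < e ->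
  \forall h \near (0 : V), `|f (h + q) - f q - 'd f q h| <= e * `|h|.
Proof.
move=> /diff_locallyP [_ /eqaddoP fo] e e0.
by apply: filterS (fo e e0) => h; rewrite /= !fctE opprD addrA.
Qed.

Lemma near_diff {V W : normedModType R} (f : V -> W) (q : V) (L : {linear V -> W}) :
  continuous L -> (forall e : R, 0 < e ->
    \forall h \near (0 : V), `|f (h + q) - f q - L h| <= e * `|h|) ->
  differentiable f q.
Proof.
move=> Lc H.
have fo : f \o shift q = cst (f q) + L +o_ 0 id.
  apply/eqaddoP => e e0.
  by apply: filterS (H e e0) => h; rewrite /= !fctE opprD addrA.
by apply/diff_locallyP; rewrite (diff_unique Lc fo).
Qed.

Lemma near_eq_differentiable {V W : normedModType R} (f g : V -> W) (q : V) :
  (\forall r \near q, f r = g r) -> differentiable f q -> differentiable g q.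
Proof.
move=> fg df; apply: (near_diff _ _ ('d f q)); first exact: diff_continuous.
move=> e e0; have fgq := nbhs_singleton fg.
move: fg; rewrite (near_shift 0) subr0 => fg.
by apply: filterS2 fg (diff_near _ _ df _ e0) => h /= <-; rewrite -fgq.
Qed.


Lemma is_derive_mx {V : normedModType R} {m n : nat} (f : V -> 'M[R]_(m, n))
    (q v : V) (D : 'M[R]_(m, n)) :
  is_derive q v f D <-> forall i j, is_derive q v (fun r => f r i j) (D i j).
Proof.
split=> [[df <-] i j|H].
  have /derivable_mxP/(_ i j) dij := df.
  by split=> //; rewrite derive_mx // mxE.
have df : derivable f q v by apply/derivable_mxP => i j; case: (H i j).
by split=> //; rewrite derive_mx //; apply/matrixP => i j; rewrite mxE; case: (H i j).
Qed.

Lemma differentiable_mx {V : normedModType R} {m n : nat} (f : V -> 'M[R]_(m, n))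
    (q : V) : (forall i j, differentiable (fun r => f r i j) q) ->
  differentiable f q.
Proof.
move=> H; rewrite (_ : f = \sum_(i < m) \sum_(j < n)
    (fun r => f r i j *: delta_mx i j)).
  by do 2![apply: differentiable_sum => ?]; apply: differentiableZl.
apply/funext => r; rewrite fct_sumE {1}[f r]matrix_sum_delta.
by apply: eq_bigr => i _; rewrite fct_sumE.
Qed.

Lemma differentiable_entry {V : normedModType R} {m n : nat}
    (f : V -> 'M[R]_(m, n)) (q : V) i j :
  differentiable f q -> differentiable (fun r => f r i j) q.
Proof.
move=> df; apply: (@differentiable_comp _ _ _ _ f (fun M => M i j : R)) => //.
exact: differentiable_coord.
Qed.

Lemma diff_is_derive {V W : normedModType R} (f : V -> W) (q v : V) :
  differentiable f q -> is_derive q v f ('D_v f q).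
Proof. by move=> /diff_derivable df; exact: derivableP. Qed.

Lemma is_derive_line {V W : normedModType R} (f : V -> W) (q v : V) (t : R) D :
  is_derive (t *: v + q) v f D -> is_derive t 1 (fun s => f (s *: v + q)) D.
Proof.
move=> /is_deriveP H; apply/is_deriveP => e e0.
apply: filterS (H e e0) => h.
by rewrite scalerDl addrA -[h *: 1]/(h * 1) mulr1.
Qed.

(** * Mean value theorem and symmetry of second derivatives *)

Lemma derive0_segment {V : normedModType R} (f : V -> R) (q v : V) :
  (forall t : R, 0 <= t <= 1 -> is_derive (t *: v + q) v f 0) ->
  f (v + q) = f q.
Proof.
move=> H; pose g (t : R) := f (t *: v + q).
have dg (t : R) : 0 <= t <= 1 -> is_derive t 1 g 0.
  by move=> /H; exact: is_derive_line.
have [t||c _] := @MVT R g (fun=> 0) 0 1 ltr01.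
- by rewrite in_itv /= => /andP[t0 t1]; apply: dg; rewrite !ltW.
- apply: derivable_within_continuous => t; rewrite in_itv /= => t01.
  by case: (dg t t01).
- by rewrite /g mul0r scale1r scale0r add0r => /subr0_eq.
Qed.

(* The mean value theorem along [v] reduces this to the first-order expansion of
   ['D_v f] at [q]; the second difference is symmetric in [v] and [w]. *)
Lemma second_difference {V : normedModType R} (f : V -> R) (q v w : V) :
  (\forall r \near q, differentiable f r) ->
  differentiable (fun r => 'D_v f r) q ->
  forall e : R, 0 < e -> \forall h \near (0 : R), 0 < h ->
    `|f (h *: v + (h *: w + q)) - f (h *: v + q) - f (h *: w + q) + f q
      - h * h * 'D_w (fun r => 'D_v f r) q| <= e * (h * h).
Proof.
move=> df dDf e e0; set D := fun r => 'D_v f r.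
(* The expansion of [D] is used at [c v + h w] and at [c v] with [c <= h]; the sum of their norms is
   at most [h (|v| + |w| + |v|)]. The 1 makes [k] positive. *)
pose k := `|v| + `|w| + `|v| + 1.
have k0 : 0 < k by rewrite /k; have := normr_ge0 v; have := normr_ge0 w; lra.
have Dnear := diff_near D q dDf (e / k) (divr_gt0 e0 k0).
move: df; rewrite (near_shift 0) subr0 => df.
have [d /= d0 Hd] := (nbhs_ballP _ _).1 (filterI df Dnear).
have {}Hd u : `|u| < d -> differentiable f (u + q) /\
    `|D (u + q) - D q - 'd D q u| <= e / k * `|u|.
  by move=> ud; apply: (Hd u); rewrite -ball_normE /= sub0r normrN.
have near_d : \forall h \near (0 : R), `|h| < d / k.
  apply/nbhs_ballP; exists (d / k) => /=; first exact: divr_gt0.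
  by move=> h; rewrite /ball /= sub0r normrN.
apply: filterS near_d => h hd h0.
have hk : h * k < d.
  by rewrite -ltr_pdivlMr //; apply: le_lt_trans (ler_norm h) hd.
have small (s : R) (u : V) : 0 <= s -> s <= h -> `|u| <= `|w| ->
    `|s *: v + h *: u| <= h * (`|v| + `|w|).
  move=> s0 sh uw; apply: (le_trans (ler_normD _ _)); rewrite !normrZ mulrDr.
  by rewrite !ger0_norm ?(ltW h0) // lerD // ?ler_wpM2r // ler_wpM2l // ltW.
have smalld (s : R) (u : V) : 0 <= s -> s <= h -> `|u| <= `|w| ->
    `|s *: v + h *: u| < d.
  move=> s0 sh uw; apply: le_lt_trans (small s u s0 sh uw) _.
  apply: le_lt_trans hk; rewrite ler_wpM2l ?(ltW h0) // /k -addrA lerDl.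
  by rewrite addr_ge0.
have w00 : `|0 : V| <= `|w| by rewrite normr0.
(* The second difference is [g h - g 0], to which the mean value theorem applies. *)
pose g (s : R) := f (s *: v + (h *: w + q)) - f (s *: v + q).
have dg (s : R) : 0 <= s -> s <= h ->
    is_derive s 1 g (D (s *: v + (h *: w + q)) - D (s *: v + q)).
  move=> s0 sh; apply: is_deriveB; apply: is_derive_line; apply: derivableP;
    apply: diff_derivable.
    by rewrite addrA; apply: (Hd _ (smalld _ _ s0 sh (lexx _))).1.
  by have := (Hd _ (smalld _ _ s0 sh w00)).1; rewrite scaler0 addr0.
have [t||c] := @MVT R g (fun s => D (s *: v + (h *: w + q)) - D (s *: v + q)) 0 h h0.
- by rewrite in_itv /= => /andP[t0 th]; apply: dg; apply: ltW.
- apply: derivable_within_continuous => t; rewrite in_itv /= => /andP[t0 th].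
  by case: (dg t t0 th).
rewrite in_itv /= => /andP[/ltW c0 /ltW ch].
rewrite {1 2}/g subr0 scale0r !add0r => gE.
have -> : f (h *: v + (h *: w + q)) - f (h *: v + q) - f (h *: w + q) + f q =
  h * (D (c *: v + (h *: w + q)) - D (c *: v + q)).
  by rewrite mulrC -gE; ring.
rewrite -mulrA -mulrBr normrM (ger0_norm (ltW h0)) mulrCA ler_wpM2l ?(ltW h0) //.
have -> : 'D_w D q = 'd D q w by exact: deriveE.
have := (Hd _ (smalld _ _ c0 ch (lexx _))).2.
have := (Hd _ (smalld _ _ c0 ch w00)).2.
have Lhw : 'd D q (h *: w) = h * 'd D q w by exact: linearZ.
rewrite scaler0 addr0 addrA linearD Lhw.
set A1 := D (c *: v + q); set A2 := D (_ + q) => near1 near2.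
have -> : A2 - A1 - h * 'd D q w =
    (A2 - D q - ('d D q (c *: v) + h * 'd D q w)) - (A1 - D q - 'd D q (c *: v)).
  by ring.
apply: (le_trans (ler_normB _ _)); apply: (le_trans (lerD near2 near1)).
rewrite -mulrDr mulrAC ler_pdivrMr // -mulrA ler_wpM2l ?(ltW e0) //.
have := small c w c0 ch (lexx _).
have : `|c *: v| <= h * `|v| by rewrite normrZ ger0_norm // ler_wpM2r.
rewrite /k !mulrDr mulr1; lra.
Qed.

Lemma schwarz {V : normedModType R} (f : V -> R) (q v w : V) :
  (\forall r \near q, differentiable f r) ->
  differentiable (fun r => 'D_v f r) q -> differentiable (fun r => 'D_w f r) q ->
  'D_w (fun r => 'D_v f r) q = 'D_v (fun r => 'D_w f r) q.
Proof.
move=> df dv dw; apply/eqP/negPn/negP => neq.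
set A := 'D_w _ q in neq *; set B := 'D_v _ q in neq *.
(* Both orders of differentiation approximate the same second difference; with this tolerance their
   errors add up to half of [h^2 |A - B|], too little to separate [A] from [B]. *)
have e0 : 0 < `|A - B| / 4 by rewrite divr_gt0 // normr_gt0 subr_eq0.
have [d /= d0 Hd] := (nbhs_ballP _ _).1
  (filterI (second_difference f q v w df dv _ e0)
           (second_difference f q w v df dw _ e0)).
have h0 : 0 < d / 2 by rewrite divr_gt0.
have [|/(_ h0) HA /(_ h0)] := Hd (d / 2).
  by rewrite /ball /= sub0r normrN ger0_norm ?(ltW h0) //; lra.
rewrite -/A in HA; rewrite -/B; move: HA; clearbody A B; move: (d / 2) h0 => h h0.
rewrite addrCA; set D1 := f (h *: w + (h *: v + q)); set D2 := f (h *: v + q).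
set D3 := f (h *: w + q) => HA HB.
have hh0 : 0 < h * h by rewrite mulr_gt0.
have : h * h * `|A - B| <= h * h * (`|A - B| / 2).
  rewrite -[X in X * `|A - B|]ger0_norm ?(ltW hh0) // -normrM.
  have -> : h * h * (A - B) = (D1 - D3 - D2 + f q - h * h * B)
    - (D1 - D2 - D3 + f q - h * h * A) by ring.
  apply: (le_trans (ler_normB _ _)); apply: (le_trans (lerD HB HA)).
  by rewrite le_eqVlt; apply/orP; left; apply/eqP; field.
by rewrite ler_pM2l //; move: e0; move: `|A - B| => N e0; lra.
Qed.

Lemma schwarz_mx {V : normedModType R} {m n : nat} (f : V -> 'M[R]_(m, n))
    (q v w : V) :
  (\forall r \near q, differentiable f r) ->
  differentiable (fun r => 'D_v f r) q -> differentiable (fun r => 'D_w f r) q ->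
  'D_w (fun r => 'D_v f r) q = 'D_v (fun r => 'D_w f r) q.
Proof.
move=> df dv dw; apply/matrixP => i j.
have entry u : \forall r \near q, 'D_u f r i j = 'D_u (fun r => f r i j) r.
  by apply: filterS df => r dfr; rewrite derive_mx ?mxE //; exact: diff_derivable.
have D2 u z : differentiable (fun r => 'D_u f r) q ->
    'D_z (fun r => 'D_u f r) q i j = 'D_z (fun r => 'D_u (fun r => f r i j) r) q.
  move=> du; rewrite derive_mx ?mxE; last exact: diff_derivable.
  exact: near_eq_derive (entry u).
apply: etrans (D2 v w dv) _; apply: etrans _ (esym (D2 w v dw)).
apply: (@schwarz V (fun r => f r i j) q v w).
- by apply: filterS df => r; exact: differentiable_entry.
- exact: near_eq_differentiable (entry v) (differentiable_entry _ _ i j dv).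
- exact: near_eq_differentiable (entry w) (differentiable_entry _ _ i j dw).
Qed.

(** * Product rules for dot, cross and scalar products *)

Lemma differentiable_dot {V : normedModType R} (f g : V -> 'cV[R]_3) (q : V) :
  differentiable f q -> differentiable g q ->
  differentiable (fun r => dot (f r) (g r)) q.
Proof.
move=> df dg; rewrite (_ : (fun r => _) = fun r => f r 0 0 * g r 0 0
  + f r 1 0 * g r 1 0 + f r 2 0 * g r 2 0); last first.
  by apply/funext => r; rewrite dotE.
by do !apply: differentiableD; apply: differentiableM; exact: differentiable_entry.
Qed.

Lemma differentiable_cross {V : normedModType R} (f g : V -> 'cV[R]_3) (q : V) :
  differentiable f q -> differentiable g q ->
  differentiable (fun r => cross (f r) (g r)) q.
Proof.
move=> df dg; apply: differentiable_mx => i j.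
rewrite (_ : (fun r => _) = fun r => f r (i + 1) 0 * g r (i + 2) 0
  - f r (i + 2) 0 * g r (i + 1) 0); last by apply/funext => r; rewrite mxE.
by apply: differentiableB; apply: differentiableM; exact: differentiable_entry.
Qed.

Lemma is_derive_mul {V : normedModType R} (f g : V -> R) (q v : V) f' g' :
  is_derive q v f f' -> is_derive q v g g' ->
  is_derive q v (fun r => f r * g r) (f' * g q + f q * g').
Proof.
move=> df dg; apply: (is_derive_eq (is_deriveM df dg)).
by rewrite addrC [f' * _]mulrC.
Qed.

Lemma is_derive_dot {V : normedModType R} (f g : V -> 'cV[R]_3) (q v : V) f' g' :
  is_derive q v f f' -> is_derive q v g g' ->
  is_derive q v (fun r => dot (f r) (g r)) (dot f' (g q) + dot (f q) g').
Proof.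
move=> /is_derive_mx df /is_derive_mx dg.
rewrite (_ : (fun r => _) = fun r => f r 0 0 * g r 0 0
  + f r 1 0 * g r 1 0 + f r 2 0 * g r 2 0); last first.
  by apply/funext => r; rewrite dotE.
have p i := is_derive_mul _ _ _ _ _ _ (df i 0) (dg i 0).
apply: (is_derive_eq (is_deriveD (is_deriveD (p 0) (p 1)) (p 2))).
by rewrite !dotE; ring.
Qed.

Lemma is_derive_cross {V : normedModType R} (f g : V -> 'cV[R]_3) (q v : V) f' g' :
  is_derive q v f f' -> is_derive q v g g' ->
  is_derive q v (fun r => cross (f r) (g r)) (cross f' (g q) + cross (f q) g').
Proof.
move=> /is_derive_mx df /is_derive_mx dg; apply/is_derive_mx => i j.
rewrite (_ : (fun r => _) = fun r => f r (i + 1) 0 * g r (i + 2) 0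
  - f r (i + 2) 0 * g r (i + 1) 0); last by apply/funext => r; rewrite mxE.
have p k l := is_derive_mul _ _ _ _ _ _ (df k 0) (dg l 0).
apply: (is_derive_eq (is_deriveB (p (i + 1) (i + 2)) (p (i + 2) (i + 1)))).
by rewrite !mxE; ring.
Qed.

Lemma is_derive_scale {V : normedModType R} {m n : nat} (a : V -> R)
    (f : V -> 'M[R]_(m, n)) (q v : V) a' f' :
  is_derive q v a a' -> is_derive q v f f' ->
  is_derive q v (fun r => a r *: f r) (a' *: f q + a q *: f').
Proof.
move=> da /is_derive_mx df; apply/is_derive_mx => i j.
rewrite (_ : (fun r => _) = fun r => a r * f r i j); last first.
  by apply/funext => r; rewrite mxE.
by apply: (is_derive_eq (is_derive_mul _ _ _ _ _ _ da (df i j))); rewrite !mxE.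
Qed.

End Calculus.

(** * Charts of a surface *)

Section Charts.
Context {R : realType}.

Lemma nbhs_center {V : normedModType R} (q : V) (P : set V) :
  nbhs (0 : V) P -> nbhs q (fun r => P (r - q)).
Proof.
move=> P0; have : \forall h \near (0 : V), P h by [].
rewrite (near_shift q) sub0r.
by apply: filterS => r /=.
Qed.

Lemma sgr_dist_lt (x y : R) : `|x - y| < `|x| -> Num.sg y = Num.sg x.
Proof.
case: (ltrgt0P x) => [x0|x0|->]; last by rewrite normr_lt0.
- by rewrite ltr_norml => /andP[_ xy]; rewrite !gtr0_sg //; lra.
- by rewrite ltr_norml => /andP[xy _]; rewrite !ltr0_sg //; lra.
Qed.

Lemma derive_plane_eq0 (f : 'cV[R]_2 -> R) q : differentiable f q ->
  'D_(delta_mx 0 0) f q = 0 -> 'D_(delta_mx 1 0) f q = 0 ->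
  forall v, is_derive q v f 0.
Proof.
move=> df; rewrite !deriveE // => f1 f2 v; split; first exact: diff_derivable.
have -> : v = v 0 0 *: delta_mx 0 0 + v 1 0 *: delta_mx 1 0.
  apply/colP => -[[|[|//]] lti]; rewrite !mxE /= !(mulr1, mulr0, addr0, add0r);
    by congr (v _ _); apply: val_inj.
have dZ (k : R) w : 'd f q (k *: w) = k * 'd f q w by exact: linearZ.
by rewrite deriveE // linearD !dZ f1 f2 !mulr0 addr0.
Qed.

(** * Matrix estimates and immersions *)

Lemma mx_entry_le (m n : nat) (M : 'M[R]_(m, n)) i j : `|M i j| <= `|M|.
Proof.
rewrite [leRHS]/Num.Def.normr /= mx_normrE.
exact: (le_bigmax _ (fun ij : 'I_m * 'I_n => `|M ij.1 ij.2|) (i, j)).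
Qed.

Lemma mulmx_lipschitz (m n : nat) (M : 'M[R]_(m, n)) :
  exists2 k : R, 0 < k & forall v : 'cV[R]_n, `|M *m v| <= k * `|v|.
Proof.
pose k := 1 + \sum_i \sum_j `|M i j|.
have k1 : 0 <= \sum_i \sum_j `|M i j| by do 2![apply: sumr_ge0 => ? _].
exists k => [|v]; first by rewrite /k; lra.
rewrite [leLHS]/Num.Def.normr /= mx_normrE bigmax_le // => [|[i j] _ /=].
  by rewrite mulr_ge0 // /k; lra.
rewrite mxE; apply: (le_trans (ler_norm_sum _ _ _)).
apply: (@le_trans _ _ (\sum_l `|M i l| * `|v|)).
  apply: ler_sum => l _; rewrite normrM ler_wpM2l // (ord1 j).
  exact: mx_entry_le.
rewrite -mulr_suml ler_wpM2r // /k [in leRHS](bigD1 i) //= addrCA lerDl.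
by rewrite addr_ge0 // sumr_ge0 // => a _; exact: sumr_ge0.
Qed.

Lemma linear_mulmx (m n : nat) (f : {linear 'cV[R]_n -> 'cV[R]_m}) :
  exists M : 'M[R]_(m, n), forall v, f v = M *m v.
Proof.
exists (\matrix_(i, j) f (delta_mx j 0) i 0) => v.
rewrite {1}[v]matrix_sum_delta linear_sum.
apply/colP => i; rewrite summxE mxE; apply: eq_bigr => j _.
by rewrite big_ord1 linearZ !mxE mulrC.
Qed.

(** The columns of [cokermx M] are killed by [M], hence vanish, so [M] has full column rank. *)
Lemma injective_left_inverse (m n : nat) (M : 'M[R]_(m, n)) :
  (forall v : 'cV[R]_n, M *m v = 0 -> v = 0) -> exists B, B *m M = 1%:M.
Proof.
move=> inj; apply/row_fullP; rewrite -cokermx_eq0; apply/eqP/matrixP => i j.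
have /inj/colP/(_ i) : M *m col j (cokermx M) = 0.
  by rewrite colE mulmxA mulmx_coker mul0mx.
by rewrite !mxE.
Qed.

(** A left inverse of the differential bounds [|h|] by [k |dX h|]. Taking the first-order error
    below [|h| / (2 k)] costs half of [|h|], which is absorbed on the left. *)
Lemma immersion_lower_bound (m n : nat) (X : 'cV[R]_n -> 'cV[R]_m) q :
  differentiable X q -> (forall v, 'd X q v = 0 -> v = 0) ->
  exists2 k : R, 0 < k &
    \forall h \near (0 : 'cV[R]_n), `|h| <= k * `|X (h + q) - X q|.
Proof.
move=> dX inj; have [J JE] := linear_mulmx _ _ ('d X q).
have [|B BJ] := injective_left_inverse _ _ J.
  by move=> v; rewrite -JE; exact: inj.
have [k k0 Bk] := mulmx_lipschitz _ _ B.
have k2 : 0 < (2 * k)^-1 by rewrite invr_gt0 mulr_gt0.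
exists (2 * k); first by rewrite mulr_gt0.
apply: filterS (diff_near _ _ dX _ k2) => h; set Y := X (h + q) - X q => Yh.
have := Bk ('d X q h); rewrite JE mulmxA BJ mul1mx -JE => hk.
have {Yh} : `|'d X q h| <= `|Y| + (2 * k)^-1 * `|h|.
  rewrite -[X in `|X|](subKr Y); apply: (le_trans (ler_normB _ _)).
  by rewrite lerD2l.
rewrite -(ler_pM2l k0) mulrDr invfM mulrA mulrCA mulfV ?gt_eqF // mulr1 => Yh.
have := le_trans hk Yh; lra.
Qed.

(** * Tangent plane, surface gradient and normal in a fixed chart *)

Variables (S : set 'cV[R]_3) (nu : 'cV[R]_3 -> 'cV[R]_3).
Hypothesis nuS : unit_normal S nu.
Variables (X : 'cV[R]_2 -> 'cV[R]_3) (A : set 'cV[R]_2).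
Hypothesis XA : chart 3 S X A.

Lemma chart_open : open A. Proof. by case: XA => -[]. Qed.

Lemma chart_near q : A q -> \forall r \near q, A r.
Proof. by move=> Aq; exact: open_nbhs_nbhs (conj chart_open Aq). Qed.

Lemma chart_diff q : A q -> differentiable X q.
Proof. by case: XA => -[_ [+ _]] _ _ _; apply. Qed.

Lemma chart_diff2 q v : A q -> differentiable (fun r => 'D_v X r) q.
Proof. by case: XA => -[_ [_ /(_ v)[+ _]]] _ _ _; apply. Qed.

Lemma chart_in q : A q -> S (X q).
Proof.
move=> Aq; case: XA => _ _ _ /(_ A chart_open (@subset_refl _ A))[V _ XE].
by have [] : (S `&` V) (X q) by rewrite -XE; exists q.
Qed.

Lemma chart_deriveE q v : A q -> 'D_v X q = 'd X q v.
Proof. by move=> /chart_diff /deriveE ->. Qed.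

Lemma chart_derive_inj q v : A q -> 'D_v X q = 0 -> v = 0.
Proof. by case: XA => _ + _ _ Aq => /(_ q Aq v). Qed.

Lemma line_continuous (q v : 'cV[R]_2) : continuous (fun t : R => t *: v + q).
Proof.
move=> t; apply: cvgD; last exact: cvg_cst.
by apply: cvgZr_tmp; exact: cvg_id.
Qed.

Lemma chart_curve q v : A q ->
  curve_on S (X q) (fun t => X (t *: v + q)) /\
  derive1 (fun t => X (t *: v + q)) 0 = 'D_v X q.
Proof.
move=> Aq.
have dline t : A (t *: v + q) ->
    is_derive t 1 (fun t => X (t *: v + q)) ('D_v X (t *: v + q)).
  move=> At; apply: is_derive_line; apply: derivableP; apply: diff_derivable.
  exact: chart_diff.
have near0 (t : R) : A (t *: v + q) -> \forall s \near t, A (s *: v + q).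
  by move=> At; apply: line_continuous; exact: chart_near.
have A0 : A (0 *: v + q) by rewrite scale0r add0r.
split; last by rewrite derive1E; case: (dline 0 A0) => _ ->; rewrite scale0r add0r.
split; first by rewrite scale0r add0r.
have [e /= e0 He] := (nbhs_ballP _ _).1 (near0 0 A0).
exists e => // t te; have At : A (t *: v + q).
  by apply: He; rewrite /ball /= sub0r normrN.
split; [exact: chart_in|by case: (dline t At)|].
set c := fun s : R => X (s *: v + q).
have dc s : A (s *: v + q) -> derive1 c s = 'D_v X (s *: v + q).
  by move=> As; rewrite derive1E; case: (dline s As).
change (derive1 c s @[s --> t] --> derive1 c t); rewrite dc //.
apply: (@cvg_trans _ ('D_v X (s *: v + q) @[s --> t])).
  apply: near_eq_cvg; apply: filterS (near0 t At) => s As.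
  by rewrite dc.
apply: (@continuous_comp _ _ _ (fun s : R => s *: v + q) (fun r => 'D_v X r) t).
  exact: line_continuous.
by apply: differentiable_continuous; exact: chart_diff2.
Qed.

Lemma chart_tangent q v : A q -> tangent S (X q) ('D_v X q).
Proof. by move=> Aq; have [c <-] := chart_curve q v Aq; eexists; [exact: c|]. Qed.

Lemma chart_unit q : A q -> dot (nu (X q)) (nu (X q)) = 1.
Proof. by move=> /chart_in Sq; case: (nuS.2 _ Sq). Qed.

Lemma chart_normal q v : A q -> dot (nu (X q)) ('D_v X q) = 0.
Proof. 
by move=> Aq; apply: (nuS.2 _ (chart_in q Aq)).2; exact: chart_tangent.
Qed.

Local Notation e1 := (delta_mx 0 0 : 'cV[R]_2).
Local Notation e2 := (delta_mx 1 0 : 'cV[R]_2).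

(** [X_1 x X_2] is along the normal; if its normal component vanished, [X_1] and [X_2] would be
    parallel, against injectivity of the differential. *)
Lemma chart_area_neq0 q : A q ->
  dot (nu (X q)) (cross ('D_e1 X q) ('D_e2 X q)) != 0.
Proof.
move=> Aq; apply/eqP => n0.
have indep a b : a *: 'D_e2 X q = b *: 'D_e1 X q -> a = 0.
  move=> /eqP; rewrite -subr_eq0 !chart_deriveE // -!linearZ -linearB /=.
  rewrite -chart_deriveE // => /eqP/(chart_derive_inj _ _ Aq)/colP/(_ 1).
  by rewrite !mxE /= mulr1 mulr0 subr0.
have := cross_normal _ _ _ (chart_unit q Aq)
  (chart_normal q e1 Aq) (chart_normal q e2 Aq).
rewrite n0 scale0r => /cross_eq0/indep/dot_eq0/(chart_derive_inj _ _ Aq)/colP/(_ 0).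
by rewrite !mxE => /eqP; rewrite oner_eq0.
Qed.

Lemma chart_tangent_plane q w : A q -> dot (nu (X q)) w = 0 ->
  exists v, w = 'D_v X q.
Proof.
move=> Aq nw; have n0 := chart_area_neq0 q Aq.
have := cramer ('D_e1 X q) ('D_e2 X q) w (nu (X q)).
rewrite [in X in _ + X](cross_normal (nu (X q))) ?chart_unit ?chart_normal //.
rewrite dotZr (dotC w) nw mulr0 scale0r addr0 => E.
exists ((dot (nu (X q)) (cross ('D_e1 X q) ('D_e2 X q)))^-1 *:
  (dot (nu (X q)) (cross w ('D_e2 X q)) *: e1 +
   dot (nu (X q)) (cross ('D_e1 X q) w) *: e2)).
rewrite chart_deriveE // linearZ linearD !linearZ -!chart_deriveE //.
by apply: (scalerI n0); rewrite scalerKV // -E.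
Qed.

Lemma chart_tangentP q w : A q ->
  tangent S (X q) w <-> dot (nu (X q)) w = 0.
Proof.
move=> Aq; split; first exact: (nuS.2 _ (chart_in q Aq)).2.
by move=> /chart_tangent_plane[//|v ->]; exact: chart_tangent.
Qed.

Lemma grad_chart f q G v : A q -> is_surface_grad S nu f (X q) G ->
  is_derive q v (f \o X) (G *m 'D_v X q).
Proof.
move=> Aq [_ /(_ _ (chart_curve q v Aq).1)].
rewrite (chart_curve q v Aq).2 => /is_deriveP H; apply/is_deriveP => e e0.
apply: filterS (H e e0) => h /=.
by rewrite addr0 scale0r add0r -[h *: 1]/(h * 1) mulr1.
Qed.

Lemma surface_grad_unique f q G G' : A q -> is_surface_grad S nu f (X q) G ->
  is_surface_grad S nu f (X q) G' -> G = G'.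
Proof.
move=> Aq GG GG'; apply: (eq_tensor (nu (X q))); first exact: chart_unit.
  by rewrite GG.1 GG'.1.
move=> v /(chart_tangent_plane _ _ Aq)[w ->].
by have [_ <-] := grad_chart f q G w Aq GG; case: (grad_chart f q G' w Aq GG').
Qed.

(** Rests on the chart being a homeomorphism onto a relatively open set: points of [S] near [X q]
    have parameters near [q]. *)
Lemma chart_nbhs q (P : set 'cV[R]_2) : A q -> nbhs q P ->
  \forall p \near X q, S p -> exists r, [/\ A r, P r & p = X r].
Proof.
move=> Aq Pq; pose B := (P `&` A)°.
have BA : B `<=` A by move=> r /interior_subset[].
have Bq : B q by apply: filterI => //; exact: chart_near.
case: XA => _ _ _ /(_ B (open_interior _) BA)[V oV XB].
have Vq : V (X q) by have [] : (S `&` V) (X q) by rewrite -XB; exists q.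
apply: filterS (open_nbhs_nbhs (conj oV Vq)) => p Vp Sp.
have : (X @` B) p by rewrite XB.
by move=> [r /interior_subset[Pr Ar] <-]; exists r.
Qed.

(** Turns an expansion in the parameter into one in the ambient displacement along [S]; the lower
    bound for immersions converts [|h|] into [|p - X q|]. *)
Lemma chart_first_order f q (G : 'M[R]_3) : A q ->
  (forall e : R, 0 < e -> \forall h \near (0 : 'cV[R]_2),
    `|f (X (h + q)) - f (X q) - G *m 'd X q h| <= e * `|h|) ->
  forall e : R, 0 < e -> \forall p \near X q, S p ->
    `|f p - f (X q) - G *m (p - X q)| <= e * `|p - X q|.
Proof.
move=> Aq dG e e0.
have [|k k0 kX] := immersion_lower_bound _ _ X q (chart_diff q Aq).
  by move=> v; rewrite -chart_deriveE //; exact: chart_derive_inj.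
have [g g0 Gg] := mulmx_lipschitz _ _ G.
(* The error of [f] contributes [d], that of [X] contributes [g d] after applying [G], and passing
   to ambient distances multiplies by [k]. *)
pose d := e / (k * (1 + g)).
have d0 : 0 < d by rewrite divr_gt0 // mulr_gt0 // addr_gt0.
have dfX := @filterI _ _ (nbhs_filter _) _ _ (dG d d0)
  (diff_near _ _ (chart_diff q Aq) _ d0).
have near_q := chart_nbhs q _ Aq
  (nbhs_center q _ (@filterI _ _ (nbhs_filter _) _ _ kX dfX)).
apply: filterS near_q => p Sq /Sq.
move=> [r [Ar + ->]]; rewrite /= !subrK => -[rX [rf rdX]].
have -> : f (X r) - f (X q) - G *m (X r - X q) =
    (f (X r) - f (X q) - G *m 'd X q (r - q))
    - G *m (X r - X q - 'd X q (r - q)).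
  move: (f (X r) - f (X q)) (X r - X q) ('d X q (r - q)) => a b c.
  by rewrite (mulmxBr G b) opprB addrA subrK.
apply: (le_trans (ler_normB _ _)).
apply: (@le_trans _ _ (d * `|r - q| + g * (d * `|r - q|))).
  by rewrite lerD // (le_trans (Gg _)) // ler_wpM2l // ltW.
have -> : d * `|r - q| + g * (d * `|r - q|) = d * (1 + g) * `|r - q| by ring.
have -> : e = d * (1 + g) * k.
  by rewrite /d; field; rewrite !gt_eqF // addr_gt0.
by rewrite -[leRHS]mulrA ler_wpM2l // mulr_ge0 ?ltW // addr_gt0.
Qed.

(** A chain rule for a field whose expansion is known on [S] only, which is enough because the curve
    stays on [S] near 0. *)
Lemma curve_chain (f : 'cV[R]_3 -> 'cV[R]_3) (x : 'cV[R]_3) (G : 'M[R]_3) c :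
  (forall e : R, 0 < e ->
    \forall p \near x, S p -> `|f p - f x - G *m (p - x)| <= e * `|p - x|) ->
  curve_on S x c -> is_derive (0 : R) 1 (f \o c) (G *m derive1 c 0).
Proof.
move=> fG [c0 [e1 e10 cS]].
have [_ dc _] := cS 0 ltac:(by rewrite normr0).
have cD : is_derive (0 : R) 1 c (derive1 c 0) by rewrite derive1E; apply: derivableP.
move/is_deriveP: cD => cD; apply/is_deriveP => e e0.
have [g g0 Gg] := mulmx_lipschitz _ _ G.
set D := derive1 c 0 in cD *.
(* The bound 1 gives [|c h - x| <= (|D| + 1) |h|]; the other one keeps the error of the curve, once
   mapped by [G], below half of [e |h|]. *)
pose d := Num.min 1 (e / (2 * g)).
have d0 : 0 < d by rewrite lt_min ltr01 divr_gt0 // mulr_gt0.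
have D1 : 0 < `|D| + 1 by rewrite ltr_wpDl.
have c0c : c @ (0 : R) --> x.
  by rewrite -c0; apply: differentiable_continuous; apply/derivable1_diffP.
have {}fG := c0c _ (fG (e / (2 * (`|D| + 1))) ltac:(by rewrite divr_gt0 ?mulr_gt0)).
have {}cS : \forall h \near (0 : R), S (c h).
  apply/nbhs_ballP; exists e1 => //= h; rewrite /ball /= sub0r normrN => /cS.
  by case.
move: (cD d d0) fG cS; apply: filterS3 => h; rewrite /= addr0 c0.
rewrite -[h *: 1]/(h * 1) mulr1 => ch fch /fch{}fch.
have -> : f (c h) - f x - h *: (G *m D) =
  (f (c h) - f x - G *m (c h - x)) + G *m (c h - x - h *: D).
  move: (f (c h) - f x) (c h - x) => a b.
  by rewrite (mulmxBr G b) -scalemxAr addrA subrK.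
have chx : `|c h - x| <= (`|D| + 1) * `|h|.
  rewrite -[c h - x](subrK (h *: D)) (le_trans (ler_normD _ _)) // normrZ.
  rewrite mulrDl mul1r addrC (mulrC `|h|) lerD2l (le_trans ch) //.
  by rewrite ler_piMl // /d ge_min lexx.
apply: (le_trans (ler_normD _ _)); apply: (le_trans (lerD fch (Gg _))).
apply: (@le_trans _ _ (e / 2 * `|h| + e / 2 * `|h|)); last first.
  by rewrite -mulrDl -splitr.
apply: lerD.
  apply: (le_trans (ler_wpM2l _ chx)).
    by rewrite ltW // divr_gt0 // mulr_gt0.
  rewrite mulrA ler_wpM2r // le_eqVlt; apply/orP; left; apply/eqP; field.
  by rewrite gt_eqF.
apply: (le_trans (ler_wpM2l (ltW g0) ch)).
rewrite mulrA ler_wpM2r // (@le_trans _ _ (g * (e / (2 * g)))) //.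
  by rewrite ler_pM2l // /d ge_min lexx orbT.
by rewrite le_eqVlt; apply/orP; left; apply/eqP; field; rewrite gt_eqF.
Qed.

(** The gradient is the differential in the chart composed with a left inverse of [dX], preceded by
    the projection that annihilates the normal. Applied to [nu], it produces the curvature
    tensor. *)
Lemma chart_surface_grad f q : A q -> differentiable (f \o X) q ->
  exists G, is_surface_grad S nu f (X q) G.
Proof.
move=> Aq df; have [J JE] := linear_mulmx _ _ ('d X q).
have [F FE] := linear_mulmx _ _ ('d (f \o X) q).
have [|B BJ] := injective_left_inverse _ _ J.
  by move=> v; rewrite -JE -chart_deriveE //; exact: chart_derive_inj.
exists (F *m B *m proj_tensor (nu (X q))); split.
  by rewrite -mulmxA proj_tensorE chart_unit // scale1r subrr mulmx0.
move=> c; apply: curve_chain; apply: chart_first_order => // e e0.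
apply: filterS (diff_near _ _ df _ e0) => h.
have FB : F *m B *m proj_tensor (nu (X q)) *m 'd X q h = F *m h.
  rewrite -mulmxA proj_tensor_tangent; last by rewrite -chart_deriveE // chart_normal.
  by rewrite JE -mulmxA (mulmxA B) BJ mul1mx.
have -> // := etrans FB (esym (FE h)).
Qed.

Lemma chart_normal_continuous q : A q -> nu (X r) @[r --> q] --> nu (X q).
Proof.
move=> Aq; have /subspace_continuousP/(_ _ (chart_in q Aq)) nuc := nuS.1.
move=> P /nuc SP0; have SP : \forall p \near X q, S p -> P (nu p) := SP0.
have Xc : X r @[r --> q] --> X q.
  by apply: differentiable_continuous; exact: chart_diff.
by apply: filterS2 (chart_near q Aq) (Xc _ SP) => r /chart_in Sr; apply.
Qed.

(* [nu] is only continuous by assumption: continuity makes the sign in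
   [nu = +- (X_1 x X_2) / |X_1 x X_2|] locally constant. *)
Lemma chart_normal_diff q : A q -> differentiable (nu \o X) q.
Proof.
move=> Aq.
pose M r := cross ('D_e1 X r) ('D_e2 X r); pose m r := dot (nu (X r)) (M r).
have dM : differentiable M q by apply: differentiable_cross; exact: chart_diff2.
have mE r : A r -> M r = m r *: nu (X r).
  by move=> Ar; apply: cross_normal; rewrite ?chart_unit ?chart_normal.
have mm r : A r -> dot (M r) (M r) = m r ^+ 2.
  by move=> Ar; rewrite {2}mE // dotZr dotC expr2.
have m0 r : A r -> m r != 0 by move=> Ar; exact: chart_area_neq0.
pose s : R := Num.sg (m q).
have s0 : s != 0 by rewrite sgr_eq0 m0.
have mc : m r @[r --> q] --> m q.
  have entry (f : 'cV[R]_2 -> 'cV[R]_3) i : f r @[r --> q] --> f q ->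
      f r i 0 @[r --> q] --> f q i 0.
    move=> fq; apply: (@continuous_comp _ _ _ f (fun v => v i 0)) => //.
    exact: coord_continuous.
  have nc := entry (nu \o X) ^~ (chart_normal_continuous q Aq).
  have Mc := entry M ^~ (differentiable_continuous dM).
  rewrite (_ : m = fun r => nu (X r) 0 0 * M r 0 0
    + nu (X r) 1 0 * M r 1 0 + nu (X r) 2 0 * M r 2 0); last first.
    by apply/funext => r; rewrite /m dotE.
  have p i : nu (X r) i 0 * M r i 0 @[r --> q] --> nu (X q) i 0 * M q i 0.
    exact: (cvgM (nc i) (Mc i)).
  exact: cvgD (cvgD (p 0) (p 1)) (p 2).
have ms : \forall r \near q, m r = s * Num.sqrt (dot (M r) (M r)).
  have : \forall r \near q, `|m q - m r| < `|m q|.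
    by move/cvgrPdist_lt : mc; apply; rewrite normr_gt0 m0.
  apply: filterS2 (chart_near q Aq) => r Ar mr; rewrite mm // sqrtr_sqr.
  by rewrite /s -(sgr_dist_lt _ _ mr) -numEsg.
apply: (@near_eq_differentiable _ _ _
  (fun r => (s * Num.sqrt (dot (M r) (M r)))^-1 *: M r)).
  apply: filterS2 (chart_near q Aq) ms => r Ar <-.
  by rewrite mE // scalerK // m0.
apply: differentiable_mx => i j.
rewrite (_ : (fun r => _) = fun r => (s * Num.sqrt (dot (M r) (M r)))^-1 * M r i j);
  last by apply/funext => r; rewrite mxE.
have MM0 : 0 < dot (M q) (M q) by rewrite mm // exprn_even_gt0 //= m0.
apply: differentiableM; last exact: differentiable_entry.
apply: differentiableV; last by rewrite mulf_neq0 // gt_eqF // sqrtr_gt0.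
apply: differentiableM; first exact: differentiable_cst.
apply: (@differentiable_comp _ _ _ _ (fun r => dot (M r) (M r)) Num.sqrt).
  exact: differentiable_dot.
by apply/derivable1_diffP; case: (is_derive1_sqrt MM0).
Qed.

Lemma drilling_chart (z : 'cV[R]_3 -> 'cV[R]_3) (a b : 'cV[R]_3 -> R) :
  (forall q, A q -> differentiable (z \o X) q) ->
  (forall v q, A q -> differentiable (fun r => 'D_v (z \o X) r) q) ->
  (forall x, S x -> a x ^+ 2 + b x ^+ 2 = 1 /\ is_surface_grad S nu z x
    (a x *: proj_tensor (nu x) + b x *: skew_tensor (nu x))) ->
  forall q, A q ->
    [/\ forall v, is_derive q v (a \o X) 0, forall v, is_derive q v (b \o X) 0 &
        b (X q) != 0 -> is_mean_curvature S nu (X q) 0].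
Proof.
move=> dz d2z abz q Aq; pose N r := nu (X r); pose Z := z \o X.
have dN : differentiable N q := chart_normal_diff q Aq.
have ZE v r : A r -> 'D_v Z r =
    a (X r) *: 'D_v X r + b (X r) *: cross (N r) ('D_v X r).
  move=> Ar; have [_ zg] := abz _ (chart_in r Ar).
  have [_ ->] := grad_chart _ _ _ v Ar zg.
  rewrite mulmxDl -!scalemxAl skew_tensorE.
  by rewrite proj_tensor_tangent // chart_normal.
pose g r := dot ('D_e1 X r) ('D_e1 X r).
have dX v : differentiable (fun r => 'D_v X r) q by exact: chart_diff2.
have dZ v : differentiable (fun r => 'D_v Z r) q := d2z v q Aq.
have g0 r : A r -> g r != 0.
  move=> Ar; apply/eqP => /dot_eq0 /(chart_derive_inj _ _ Ar)/colP/(_ 0).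
  by rewrite !mxE => /eqP; rewrite oner_eq0.
have dg : differentiable (fun r => (g r)^-1) q.
  by apply: differentiableV; [exact: differentiable_dot|exact: g0].
(* The coefficients are only given pointwise; their regularity comes from recovering them as
   quotients, [a] from [X_1 . Z_1] and, below, [b] from [(N x X_1) . Z_1], both over [X_1 . X_1]. *)
have da : differentiable (a \o X) q.
  apply: (@near_eq_differentiable _ _ _
    (fun r => dot ('D_e1 X r) ('D_e1 Z r) * (g r)^-1)).
    apply: filterS (chart_near q Aq) => r Ar /=; rewrite ZE // !dot_lin.
    by rewrite dot_crossr mulr0 addr0 mulfK // g0.
  by apply: differentiableM => //; exact: differentiable_dot.
have db : differentiable (b \o X) q.
  apply: (@near_eq_differentiable _ _ _
    (fun r => dot (cross (N r) ('D_e1 X r)) ('D_e1 Z r) * (g r)^-1)).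
    apply: filterS (chart_near q Aq) => r Ar /=; rewrite ZE // !dot_lin.
    rewrite (dotC _ ('D_e1 X r)) dot_crossr mulr0 add0r dot_cross_cross.
    by rewrite chart_unit // chart_normal // mul1r expr0n subr0 mulfK // g0.
  apply: differentiableM => //; apply: differentiable_dot => //.
  exact: differentiable_cross.
have ZZ v w : 'D_w (fun r => 'D_v Z r) q =
    ('D_w (a \o X) q *: 'D_v X q + a (X q) *: 'D_w (fun r => 'D_v X r) q) +
    ('D_w (b \o X) q *: cross (N q) ('D_v X q) + b (X q) *:
      (cross ('D_w N q) ('D_v X q) + cross (N q) ('D_w (fun r => 'D_v X r) q))).
  have [_ <-] := is_deriveD
    (is_derive_scale _ _ _ _ _ _ (diff_is_derive _ _ w da)
      (diff_is_derive _ _ w (dX v)))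
    (is_derive_scale _ _ _ _ _ _ (diff_is_derive _ _ w db)
      (is_derive_cross _ _ _ _ _ _ (diff_is_derive _ _ w dN)
        (diff_is_derive _ _ w (dX v)))).
  by apply: near_eq_derive; apply: filterS (chart_near q Aq) => r Ar; rewrite ZE.
have e12 : forall v w, 'D_w (fun r => 'D_v Z r) q = 'D_v (fun r => 'D_w Z r) q.
  by move=> v w; apply: schwarz_mx => //; apply: filterS (chart_near q Aq).
have X12 : 'D_e2 (fun r => 'D_e1 X r) q = 'D_e1 (fun r => 'D_e2 X r) q.
  by apply: schwarz_mx => //; apply: filterS (chart_near q Aq); exact: chart_diff.
have E := etrans (esym (ZZ e1 e2)) (etrans (e12 e1 e2) (ZZ e2 e1)).
move: E; rewrite X12 => /vec_cancel E.
(* Differentiate [N . N = 1]; the next relation comes likewise from [a^2 + b^2 = 1]. *)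
have NN w : dot (N q) ('D_w N q) = 0.
  have dNN := is_derive_dot _ _ _ _ _ _ (diff_is_derive _ _ w dN)
    (diff_is_derive _ _ w dN).
  have NN1 : \forall r \near q, dot (N r) (N r) = cst 1 r.
    by apply: filterS (chart_near q Aq) => r Ar; rewrite chart_unit.
  have := near_eq_is_derive NN1 dNN => -[_]; rewrite derive_cst.
  rewrite (dotC _ (N q)); lra.
have ab1 w : a (X q) * 'D_w (a \o X) q + b (X q) * 'D_w (b \o X) q = 0.
  have dab := is_deriveD
    (is_derive_mul _ _ _ _ _ _ (diff_is_derive _ _ w da) (diff_is_derive _ _ w da))
    (is_derive_mul _ _ _ _ _ _ (diff_is_derive _ _ w db) (diff_is_derive _ _ w db)).
  have ab1 : \forall r \near q, a (X r) * a (X r) + b (X r) * b (X r) = cst 1 r.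
    apply: filterS (chart_near q Aq) => r Ar.
    by rewrite -!expr2; case: (abz _ (chart_in r Ar)).
  have := near_eq_is_derive ab1 dab => -[_]; rewrite derive_cst /=.
  by move: ('D_w (a \o X) q) ('D_w (b \o X) q) => ? ?; lra.
have [a1 a2 b1 b2 bN] := drilling_compatibility _ _ _ _ _ _ _ _ _ _ _
  (chart_unit q Aq) (chart_normal q e1 Aq) (chart_normal q e2 Aq) (NN e1) (NN e2)
  (chart_area_neq0 q Aq) (abz _ (chart_in q Aq)).1 (ab1 e1) (ab1 e2) E.
split; [exact: derive_plane_eq0 da a1 a2|exact: derive_plane_eq0 db b1 b2|move=> b0].
have [G nuG] := chart_surface_grad nu q Aq dN.
exists G; [exact: nuG|rewrite mulr0].
have GE v : G *m 'D_v X q = 'D_v N q by case: (grad_chart nu q G v Aq nuG).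
exact: esym (tangential_trace_eq0 _ _ _ _ _ _ _ nuG.1 (GE e1) (GE e2)
  (chart_area_neq0 q Aq) b0 bN).
Qed.

(** The field is constant along segments issued from [q] in a ball inside [A], and these parameters
    cover a neighbourhood in [S]. *)
Lemma chart_locally_constant (f : 'cV[R]_3 -> R) :
  (forall q v, A q -> is_derive q v (f \o X) 0) ->
  forall q, A q -> \forall p \near X q, S p -> f p = f (X q).
Proof.
move=> df q Aq; have [d /= d0 Ad] := (nbhs_ballP _ _).1 (chart_near q Aq).
have Pq : \forall r \near q, f (X r) = f (X q).
  apply/nbhs_ballP; exists d => //= r; rewrite -ball_normE /= => qr.
  rewrite -[r in LHS](subrK q); apply: (derive0_segment (f \o X)) => t /andP[t0 t1].
  apply: df; apply: Ad; rewrite -ball_normE /= opprD addrC subrK normrN normrZ.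
  by rewrite ger0_norm // distrC (le_lt_trans _ qr) // ler_piMl.
by apply: filterS (chart_nbhs q _ Aq Pq) => p + Sp => /(_ Sp)[r [_ + ->]].
Qed.

End Charts.

(** * Drilling isometries *)

Section Global.
Context {R : realType}.

(** The set of points of [S] where [f] takes the value [f x] is open and closed relative to [S]. *)
Lemma connected_locally_constant (T : topologicalType) (U : Type) (S : set T)
    (f : T -> U) : connected S ->
  (forall x, S x -> \forall p \near x, S p -> f p = f x) ->
  forall x y, S x -> S y -> f x = f y.
Proof.
move=> cS lf x y Sx Sy; pose B := [set p | S p /\ f p = f x].
have -> // : f y = f x; suff : B y by case.
rewrite (cS B) //; first by exists x.
- exists [set p | S p -> f p = f x]°; first exact: open_interior.
  apply/seteqP; split=> [p [Sp fp]|p [Sp /interior_subset fp]].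
    by split=> //; apply: filterS (lf p Sp) => p' + /[dup] Sp' => /[apply] ->.
  by split; [|exact: fp].
- exists (~` [set p | S p -> f p <> f x]°).
    by apply: open_closedC; exact: open_interior.
  apply/seteqP; split=> [p [Sp fp]|p [Sp np]].
    by split=> // /interior_subset; apply.
  split=> //; apply: contrapT => fp; apply: np.
  by apply: filterS (lf p Sp) => p' + /[dup] Sp' => /[apply] ->.
Qed.

(** The sine of [acos a] is [|b|], so the sign of [b] decides between [acos a] and its opposite. *)
Lemma circle_angle (a b : R) : a ^+ 2 + b ^+ 2 = 1 ->
  exists t : R, cos t = a /\ sin t = b.
Proof.
move=> ab; have a1 : -1 <= a <= 1.
  rewrite -ler_norml -(@ler_pXn2r _ 2) ?nnegrE // expr1n real_normK ?num_real //.
  by rewrite -ab lerDl sqr_ge0.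
have sa : sin (acos a) = `|b|.
  by rewrite sin_acos // -sqrtr_sqr -ab addrC addKr.
have [b0|b0] := leP 0 b.
  by exists (acos a); rewrite acosK ?in_itv //= sa ger0_norm.
exists (- acos a); rewrite cosN sinN acosK ?in_itv //= sa ltr0_norm //.
by rewrite opprK.
Qed.

Lemma is_derive_mulmx {V : normedModType R} {m n : nat} (M : 'M[R]_(m, n))
    (f : V -> 'cV[R]_n) (q v : V) D :
  is_derive q v f D -> is_derive q v (fun r => M *m f r) (M *m D).
Proof.
move=> /is_deriveP fD; apply/is_deriveP => e e0.
have [k k0 Mk] := mulmx_lipschitz _ _ M.
apply: filterS (fD (e / k) (divr_gt0 e0 k0)) => h fh.
rewrite scalemxAr -!mulmxBr (le_trans (Mk _)) //.
by rewrite -ler_pdivlMl // mulrA [k^-1 * e]mulrC.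
Qed.

Lemma differentiable_mulmx {V : normedModType R} {m n : nat} (M : 'M[R]_(m, n))
    (f : V -> 'cV[R]_n) (q : V) :
  differentiable f q -> differentiable (fun r => M *m f r) q.
Proof.
move=> df; apply: differentiable_mx => i j.
rewrite (_ : (fun r => _) = \sum_k (fun r => M i k * f r k j)); last first.
  by apply/funext => r; rewrite fct_sumE mxE.
apply: differentiable_sum => k; apply: differentiableM; first exact: differentiable_cst.
exact: differentiable_entry.
Qed.

Variables (S : set 'cV[R]_3) (nu : 'cV[R]_3 -> 'cV[R]_3).

Lemma surface_grad_mulmx (Q : 'M[R]_3) y x G : is_surface_grad S nu y x G ->
  is_surface_grad S nu (fun x => Q *m y x) x (Q *m G).
Proof.
move=> [Gn yG]; split=> [|c /yG]; first by rewrite -mulmxA Gn mulmx0.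
by rewrite -mulmxA; exact: is_derive_mulmx.
Qed.

Hypotheses (surfS : surface 3 S) (nuS : unit_normal S nu).

(** By uniqueness the gradient that preserves angles and areas is [Rot x *m U x]; since [Rot x]
    preserves lengths, [U x] is a symmetric positive isometry of the tangent plane. *)
Lemma isometric_stretch y Rot U x : polar_decomposition S nu y Rot U ->
  isometric S nu y -> S x -> U x = proj_tensor (nu x).
Proof.
move=> polar iso Sx; have [n1 _] := nuS.2 x Sx.
have [yG SR UT Un Upos] := polar x Sx.
have [G [yG' Gcos Garea]] := iso x Sx.
have [X [A [XA [q Aq Xq]]]] := surfS x Sx.
have tP w : dot (nu x) w = 0 -> tangent S x w.
  by rewrite -Xq => nw; apply/(chart_tangentP _ _ nuS _ _ XA).
have GE : G = Rot x *m U x.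
  move: yG yG'; rewrite -Xq => yG yG'.
  exact: (surface_grad_unique _ _ nuS _ _ XA _ _ _ _ Aq yG' yG).
apply: (symmetric_isometry_proj (nu x)) => // [v nv|v nv].
  by apply: Upos; exact: tP.
rewrite -(SO3_dot (Rot x)) // !mulmxA -GE.
apply: (conformal_equiareal_isometry (nu x)) => // [u w nu0 nw0|u w nu0 nw0].
  by apply: Gcos; exact: tP.
by apply: Garea; exact: tP.
Qed.

Lemma drilling_components y Rot U Q x : polar_decomposition S nu y Rot U ->
  isometric S nu y -> drilling_frame S nu Rot Q -> S x ->
  exists ab : R * R, ab.1 ^+ 2 + ab.2 ^+ 2 = 1 /\
    Q *m (Rot x *m U x) = ab.1 *: proj_tensor (nu x) + ab.2 *: skew_tensor (nu x).
Proof.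
move=> polar iso [_ bd] Sx; have [Rd [QR rotRd _]] := bd x Sx.
have [n1 _] := nuS.2 x Sx.
have [a [b [ab Rab]]] := rotation_about_tensor (nu x) Rd n1 rotRd.
exists (a, b); split=> //=; rewrite (isometric_stretch y Rot U x polar iso Sx).
by rewrite mulmxA QR mul1mx.
Qed.

Lemma drilling_frame_bonnet y Rot U Q : connected S ->
  deformation S nu y Rot U -> isometric S nu y -> nontrivial S Rot ->
  ~ uniform_rotoinversion S nu y -> drilling_frame S nu Rot Q ->
  bonnet_transformation S nu (fun x => Q *m y x).
Proof.
move=> connS [y2 polar] iso nontriv noinv frameQ; have [SQ bd] := frameQ.
have UE x := isometric_stretch y Rot U x polar iso.
have [ab abE] : exists ab : 'cV[R]_3 -> R * R, forall x, S x ->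
    (ab x).1 ^+ 2 + (ab x).2 ^+ 2 = 1 /\
    Q *m (Rot x *m U x) =
      (ab x).1 *: proj_tensor (nu x) + (ab x).2 *: skew_tensor (nu x).
  (* The coefficients are chosen at every point of space; off [S] the condition is vacuous and the
     pair is a placeholder. *)
  suff H x : exists p : R * R, S x -> p.1 ^+ 2 + p.2 ^+ 2 = 1 /\
      Q *m (Rot x *m U x) = p.1 *: proj_tensor (nu x) + p.2 *: skew_tensor (nu x).
    by have [ab abE] := choice H; exists ab.
  have [Sx|nSx] := pselect (S x); last by exists (0, 0).
  by have [p Hp] := drilling_components y Rot U Q x polar iso frameQ Sx; exists p.
pose a x := (ab x).1; pose b x := (ab x).2.
have zG x : S x -> a x ^+ 2 + b x ^+ 2 = 1 /\ is_surface_grad S nu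
    (fun x => Q *m y x) x (a x *: proj_tensor (nu x) + b x *: skew_tensor (nu x)).
  move=> Sx; have [ab1 <-] := abE x Sx; split=> //.
  by apply: surface_grad_mulmx; case: (polar x Sx).
have local X A : chart 3 S X A -> forall q, A q ->
    [/\ forall v, is_derive q v (a \o X) 0, forall v, is_derive q v (b \o X) 0 &
        b (X q) != 0 -> is_mean_curvature S nu (X q) 0].
  move=> XA; have [dy d2y] := y2 X A XA.
  apply: (drilling_chart S nu nuS X A XA (fun x => Q *m y x) a b) zG => [q Aq|v q Aq].
    by apply: differentiable_mulmx; exact: dy.
  apply: (@near_eq_differentiable _ _ _ (fun r => Q *m 'D_v (y \o X) r)).
    apply: filterS (chart_near _ _ _ XA q Aq) => r Ar.
    by have [_ ->] := is_derive_mulmx Q _ _ _ _ (diff_is_derive _ _ v (dy r Ar)).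
  by apply: differentiable_mulmx; exact: (d2y v).1.
have const f : (forall X A, chart 3 S X A -> forall q, A q ->
    forall v, is_derive q v (f \o X) 0) ->
    forall x x', S x -> S x' -> f x = f x' :> R.
  move=> df; apply: connected_locally_constant => // x Sx.
  have [X [A [XA [q Aq <-]]]] := surfS x Sx.
  apply: (chart_locally_constant S X A XA) => // r v Ar.
  exact: df XA r Ar v.
have a_const : forall x x', S x -> S x' -> a x = a x'.
  by apply: const => X A XA q Aq; case: (local X A XA q Aq).
have b_const : forall x x', S x -> S x' -> b x = b x'.
  by apply: const => X A XA q Aq; case: (local X A XA q Aq).
(* On an empty surface every polar rotation would be constant. *)
have [x0 Sx0] : exists x, S x.
  apply: contrapT => S0; apply: nontriv; exists 1%:M => x Sx.
  by case: S0; exists x.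
have QRP x : S x -> Q *m (Rot x *m proj_tensor (nu x)) =
    a x0 *: proj_tensor (nu x) + b x0 *: skew_tensor (nu x).
  move=> Sx; have [_] := abE x Sx; rewrite (UE x Sx) => ->.
  by rewrite -(a_const x x0) // -(b_const x x0).
have QR x (r : R) : S x -> a x0 = r -> b x0 = 0 ->
    Rot x *m proj_tensor (nu x) = r *: (Q^T *m proj_tensor (nu x)).
  move=> Sx ar b0; have := congr1 (mulmx Q^T) (QRP x Sx).
  by rewrite mulmxA SQ.1 mul1mx ar b0 scale0r addr0 -scalemxAr.
(* If the sine vanishes, the cosine is 1 or -1 on all of [S]. For 1, [Rot] agrees with [Q^T] on the
   tangent plane and, the drilling fixing [nu], on the normal, so it is constant. For -1, the
   gradient of [y] is [- Q^T P(nu)], a uniform rotoinversion. *)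
have b0 : b x0 != 0.
  apply/eqP => b0; have [+ _] := zG x0 Sx0.
  rewrite b0 expr0n addr0 => /eqP; rewrite sqrf_eq1 => /orP[]/eqP a0.
    apply: nontriv; exists Q^T => x Sx; have [n1 _] := nuS.2 x Sx.
    apply: (eq_tensor (nu x)) => // [|v nv].
      have [Rd [QRd [_ Rdn] _]] := bd x Sx.
      have QRn : Q *m (Rot x *m nu x) = nu x by rewrite mulmxA QRd mul1mx.
      by rewrite -[in RHS]QRn mulmxA SQ.1 mul1mx.
    have := congr1 (mulmx^~ v) (QR x 1 Sx a0 b0).
    by rewrite scale1r -!mulmxA proj_tensor_tangent.
  apply: noinv; exists Q^T; first exact: SO3_tr.
  move=> x Sx; have [yG _ _ _ _] := polar x Sx.
  by move: yG; rewrite UE // (QR x (-1)) // scaleN1r.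
split=> [x Sx|].
  have [X [A [XA [q Aq Xq]]]] := surfS x Sx.
  have [_ _] := local X A XA q Aq; rewrite Xq; apply.
  by rewrite (b_const x x0).
have [t [ct st]] := circle_angle _ _ (zG x0 Sx0).1.
exists t => x Sx; rewrite ct st -(a_const x) // -(b_const x) //.
exact: (zG x Sx).2.
Qed.

End Global.

Theorem proposition6 (R : realType) (S : set 'cV[R]_3)
    (nu y : 'cV[R]_3 -> 'cV[R]_3) (Rot U : 'cV[R]_3 -> 'M[R]_3)
    (surfS : surface 3 S) (connS : connected S) (nuS : unit_normal S nu)
    (defy : deformation S nu y Rot U) (isoy : isometric S nu y)
    (nontriv : nontrivial S Rot) (noinv : ~ uniform_rotoinversion S nu y) :
  pure_drilling S nu Rot ->
  minimal_surface S nu /\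
  forall Q, drilling_frame S nu Rot Q ->
    bonnet_transformation S nu (fun x => Q *m y x).
Proof.
move=> [Q frameQ].
have bonnet Q' := drilling_frame_bonnet S nu surfS nuS y Rot U Q' connS defy isoy
  nontriv noinv.
by split; [exact: (bonnet Q frameQ).1|exact: bonnet].
Qed.
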